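(* Let $\mathbf d$, $S=\{i_1<\dots<i_s\}$, $\gamma$, $\delta$, $C$, $\mathbf d_S$ and $\mathbf d_H$ be as in the context, satisfying the standing assumptions there. Then with probability $1-O(1/\sqrt{\log M})$ all of the following hold simultaneously: (a) for all $k\in[s]$ with $d(i_k)\ge \delta^{1/32}C$, $$d_S(k)=\gamma\, d(i_k)\bigl(1\pm 8\delta^{1/64}\bigr)=d_H(k)\bigl(1\pm 12\delta^{1/64}\bigr);$$ (b) for all $k\in[s]$ with $d(i_k)<\delta^{1/32}C$, $\max\{d_S(k),d_H(k)\}\le 2\gamma\delta^{1/32}C$; (c) for all integers $0\le i\le \tfrac12\gamma C$, $$|n_i(\mathbf d_S)-n_i(\mathbf d_H)|\le \frac{\gamma\, n_i(\mathbf d_H)}{C^3}+\gamma C^5 .$$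
   Context: All asymptotics are as $n\to\infty$. For each $n$, let $\mathbf d=(d(1),\dots,d(n))$ be a sequence of integers with $1\le d(1)\le\cdots\le d(n)$ and even sum; let $M=\sum_{i=1}^n d(i)$ (so $M\to\infty$), $\Delta=d(n)$, and $d(A)=\sum_{i\in A}d(i)$ for $A\subseteq[n]$. Let $G$ be a uniformly random simple graph on vertex set $[n]$ in which vertex $i$ has degree $d(i)$ for all $i$. Let $S=\{i_1,\dots,i_s\}\subseteq[n]$ with $i_1<\dots<i_s$ be a given set and $\gamma=d(S)/M$. Standing assumptions: there is a function $\delta=\delta(n)\to 0$ with $\delta^{-1}=O(\log\log M)$ such that $\Delta^2(\gamma^{-1}\log M)^{12}\le \delta\, d(S)$, and there is a constant $c>0$ with $\gamma<1-c$. Define $C=\delta^{-1/16}\gamma^{-1}\log M$. Let $d_S(k)$ denote the degree of vertex $i_k$ in the induced subgraph $G[S]$, and $\mathbf d_S=(d_S(1),\dots,d_S(s))$. For a sequence $\mathbf x$, $n_k(\mathbf x)$ is the number of entries of $\mathbf x$ equal to $k$. Definition of $\mathbf d_H$: let $Z_j\sim\mathrm{Bin}(j,\gamma)$; for $k\ge 0$ let $N(k)=\lfloor \sum_{i\in S}\Pr(Z_{d(i)}\le k)+\tfrac12\rfloor$ and $N(-1)=0$; $\mathbf d_H=(d_H(1),d_H(2),\dots)$ is the non-decreasing sequence with $n_k(\mathbf d_H)=N(k)-N(k-1)$ for all $k\ge 0$. The notation $x=y(1\pm\epsilon)$ means $|x-y|\le \epsilon y$. *)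

(* Defs.v *)
From HB Require Import structures.
From mathcomp Require Import all_boot all_order all_algebra.
From mathcomp Require Import all_classical all_reals all_analysis.
Set Implicit Arguments. Unset Strict Implicit. Unset Printing Implicit Defensive.
Import Order.TTheory GRing.Theory Num.Theory.
Local Open Scope ring_scope.

(* A simple graph on vertex set 'I_n (= [n], shifted by one) is given by its
   edge set: a set of 2-element subsets of 'I_n. *)
Definition is_simple_graph (n : nat) (E : {set {set 'I_n}}) : bool :=
  [forall e in E, #|e| == 2]%N.

Definition gdeg (n : nat) (E : {set {set 'I_n}}) (v : 'I_n) : nat :=
  #|[set e in E | v \in e]|.

Definition gdeg_in (n : nat) (E : {set {set 'I_n}}) (S : {set 'I_n}) (v : 'I_n) : nat :=
  #|[set e in E | (v \in e) && (e \subset S)]|.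

Definition has_degrees (n : nat) (d : 'I_n -> nat) (E : {set {set 'I_n}}) : bool :=
  is_simple_graph E && [forall v, gdeg E v == d v].

(* the set of all such graphs: the sample space of G (uniform measure) *)
Definition graphs_deg (n : nat) (d : 'I_n -> nat) : {set {set {set 'I_n}}} :=
  [set E | has_degrees d E].

Definition Msum (n : nat) (d : 'I_n -> nat) : nat := (\sum_(i : 'I_n) d i)%N.
Definition maxdeg (n : nat) (d : 'I_n -> nat) : nat := (\max_(i : 'I_n) d i)%N.
Definition dset (n : nat) (d : 'I_n -> nat) (A : {set 'I_n}) : nat := (\sum_(i in A) d i)%N.

Definition gam {R : realType} (n : nat) (d : 'I_n -> nat) (S : {set 'I_n}) : R :=
  (dset d S)%:R / (Msum d)%:R.

Definition binom_cdf {R : realType} (g : R) (j k : nat) : R :=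
  \sum_(t < k.+1) ('C(j, t))%:R * g ^+ t * (1 - g) ^+ (j - t).

(* N(k) = floor( sum_{i in S} Pr(Z_{d(i)} <= k) + 1/2 ), for k >= 0
   (the argument is nonnegative, so the floor is a natural number) *)
Definition Nfun {R : realType} (n : nat) (d : 'I_n -> nat) (S : {set 'I_n}) (k : nat) : nat :=
  `|Num.floor (\sum_(i in S) binom_cdf (gam d S : R) (d i) k + 2^-1)|%N.

Definition nH {R : realType} (n : nat) (d : 'I_n -> nat) (S : {set 'I_n}) (k : nat) : nat :=
  (Nfun (R:=R) d S k - (if k is k'.+1 then Nfun (R:=R) d S k' else 0))%N.

(* d_H: the non-decreasing sequence with exactly n_k(d_H) entries equal to k.
   For k >= Delta every Pr(Z_{d(i)} <= k) = 1, so N(k) = s and n_k(d_H) = 0: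
   listing the values 0..Delta suffices. *)
Definition dHseq {R : realType} (n : nat) (d : 'I_n -> nat) (S : {set 'I_n}) : seq nat :=
  flatten [seq nseq (nH (R:=R) d S k) k | k <- iota 0 (maxdeg d).+1].

Definition nk (x : seq nat) (k : nat) : nat := count (pred1 k) x.

(* i_k : the k-th smallest element of S (0-indexed; enum S is increasing) *)
Definition iS (n : nat) (S : {set 'I_n}) (k : 'I_#|S|) : 'I_n := enum_val k.

Definition dSseq (n : nat) (E : {set {set 'I_n}}) (S : {set 'I_n}) : seq nat :=
  [seq gdeg_in E S v | v <- enum S].

Definition approx {R : realType} (x y eps : R) : Prop := `|x - y| <= eps * y.

Definition good_event {R : realType} (n : nat) (d : 'I_n -> nat) (S : {set 'I_n})
    (delta : R) (E : {set {set 'I_n}}) : Prop :=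
  let g : R := gam d S in
  let C : R := delta `^ (- (16%:R)^-1) * g^-1 * ln ((Msum d)%:R) in
  let dH := dHseq (R:=R) d S in
  let e64 := delta `^ ((64%:R)^-1) in
  let e32 := delta `^ ((32%:R)^-1) in
  (forall k : 'I_#|S|, e32 * C <= (d (iS k))%:R ->
     approx ((gdeg_in E S (iS k))%:R) (g * (d (iS k))%:R) (8%:R * e64) /\
     approx ((gdeg_in E S (iS k))%:R) ((nth 0%N dH k)%:R) (12%:R * e64)) /\
  (forall k : 'I_#|S|, (d (iS k))%:R < e32 * C ->
     (maxn (gdeg_in E S (iS k)) (nth 0%N dH k))%:R <= 2%:R * g * e32 * C) /\
  (forall i : nat, (i%:R <= 2^-1 * g * C) ->
     `|(nk (dSseq E S) i)%:R - (nk dH i)%:R| <=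
        g * (nk dH i)%:R / C ^+ 3 + g * C ^+ 5).

(* Main.v *)
Require Import Defs.
From HB Require Import structures.
From mathcomp Require Import all_boot all_order all_algebra.
From mathcomp Require Import all_classical all_reals all_analysis.
From mathcomp Require Import zify ring lra.
Import Order.TTheory GRing.Theory Num.Theory.
Local Open Scope ring_scope.

(* Write X_v for the number of neighbours of v in S, and D = Delta.  Replacing
   edges vw, xy by vx, wy with x in S and w outside S raises X_v by one; double
   counting shows that the numbers t_j of graphs with X_v = j satisfy
     (j+1)(1-gamma) t_{j+1} = (d(v)-j) gamma t_j (1 + O(D^2/(gamma M))),
   which up to the error is the recursion of the Bin(d(v), gamma) weights.
   Tails: away from the mean consecutive weights decay geometrically, both for
   t_j and for the binomial, and the latter controls d_H; this gives (a), (b).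
   Counts: when d(v) < C the errors multiply up to 1 + O(C^-9), so t_j itself is
   nearly binomial.  Running the switching with the neighbourhood of a second
   vertex u frozen (on graphs where u, v are not adjacent; adjacent pairs are
   removed by one more switching) makes X_u and X_v nearly independent, and (c)
   follows from Chebyshev's inequality, since by AM-GM the permitted deviation
   squared is at least 2 (gamma C)^2 times the mean, while only about gamma C / 2
   values of i are involved. *)

(** The exponents are fixed by one budget. In terms of C, the assumption on Delta reads D^2 C^12 <=
    delta^(1/4) d(S). Two of the twelve powers pay for constants, so one switching step has relative
    error C^-10. Two vertices of degree below C need at most 2C steps, which raises the error to
    O(C^-9), and adjacent pairs cost O(C^4/M) = O(C^-8). With joint probabilities known up to 1 +
    O(C^-8), dependence adds O(C^-8 mean^2) to the variance. This is (gamma mean / C^3)^2 divided by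
    (gamma C)^2 up to a constant, so the first term of the deviation permitted in (c) is just large
    enough.

    Estimates are inequalities between numbers of graphs, multiplied through by the total, so no
    graph with the given degrees has to be exhibited. The sequence d_H is never compared with random
    degrees directly: both are compared with binomial weights, and d_H(k) is located as a quantile
    of the rounded sum of binomial distribution functions. *)

Set Implicit Arguments. Unset Strict Implicit. Unset Printing Implicit Defensive.

(** * Edge switchings and their double counting *)

Section Switching.
Import mathcomp.boot.finset.
Local Open Scope nat_scope.

Lemma card_dpair (I J : finType) (A : {set I}) (F : I -> {set J}) :
  #|[set p : I * J | (p.1 \in A) && (p.2 \in F p.1)]| = \sum_(x in A) #|F x|.
Proof.
rewrite -sum1_card (eq_bigl (fun p => (p.1 \in A) && (p.2 \in F p.1))); last first.
  by move=> p; rewrite inE.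
rewrite -(pair_big_dep (fun x => x \in A) (fun x y => y \in F x) (fun _ _ => 1)) /=.
by apply: eq_bigr => x _; rewrite sum1_card.
Qed.

Variable n : nat.
Implicit Types (E : {set {set 'I_n}}) (A B S U : {set 'I_n}) (v w x y z : 'I_n).

Definition nbr E v : {set 'I_n} := [set w | [set v; w] \in E].

Lemma set2C x y : [set x; y] = [set y; x].
Proof. by rewrite setUC. Qed.

Lemma nbr_sym E v w : (w \in nbr E v) = (v \in nbr E w).
Proof. by rewrite !inE set2C. Qed.

Lemma eq_set2 x y z t :
  ([set x; y] == [set z; t]) = (x == z) && (y == t) || (x == t) && (y == z).
Proof.
apply/eqP/idP => [/setP H|]; last first.
  by case/orP => /andP[/eqP-> /eqP->] //; rewrite set2C.
have := H x; have := H y; have := H z; have := H t; rewrite !inE !eqxx ?orbT /=.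
rewrite ![z == _]eq_sym ![t == _]eq_sym.
by case: (x == z); case: (x == t); case: (y == z); case: (y == t).
Qed.

Lemma simple_card E e : is_simple_graph E -> e \in E -> #|e| = 2.
Proof. by move=> /forall_inP H /H /eqP. Qed.

Lemma nbr_irrefl E v : is_simple_graph E -> v \notin nbr E v.
Proof.
by move=> sE; apply/negP; rewrite inE setUid => /(simple_card sE); rewrite cards1.
Qed.

Lemma card_edges_at E v (P : pred {set 'I_n}) : is_simple_graph E ->
  #|[set e in E | (v \in e) && P e]| = #|[set w in nbr E v | P [set v; w]]|.
Proof.
move=> sE; rewrite -[RHS](card_in_imset (f := fun w => [set v; w])); last first.
  move=> w w' _ _ /eqP; rewrite eq_set2 eqxx /= => /orP[/eqP //|].
  by move=> /andP[/eqP-> /eqP->].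
apply: eq_card => e; rewrite inE; apply/idP/imsetP => [/and3P[eE ve Pe]|].
  have /eqP/cards2P[a [b [ab De]]] := simple_card sE eE.
  have [w Dw] : exists w, e = [set v; w].
    move: ve; rewrite De !inE => /orP[/eqP->|/eqP->]; first by exists b.
    by exists a; rewrite set2C.
  by exists w => //; rewrite !inE -Dw eE Pe.
by move=> [w]; rewrite !inE => /andP[wE Pw] ->; rewrite wE Pw !inE eqxx.
Qed.

Lemma gdegE E v : is_simple_graph E -> gdeg E v = #|nbr E v|.
Proof.
move=> sE; have := card_edges_at v predT sE; rewrite /gdeg => H.
transitivity #|[set e in E | (v \in e) && predT e]|.
  by apply: eq_card => e; rewrite !inE andbT.
by rewrite H; apply: eq_card => e; rewrite !inE andbT.
Qed.

Lemma gdeg_inE E S v : is_simple_graph E -> v \in S ->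
  gdeg_in E S v = #|nbr E v :&: S|.
Proof.
move=> sE vS; rewrite /gdeg_in (card_edges_at v (fun e => e \subset S) sE).
by apply: eq_card => w; rewrite !inE subUset !sub1set vS.
Qed.

Definition switch v w x y E : {set {set 'I_n}} :=
  (E :\: [set [set v; w]; [set x; y]]) :|: [set [set v; x]; [set w; y]].

(** Together with [switch_symx] this moves any of the four vertices into the place of [v], so facts
    about a switching need proof at [v] only. *)
Lemma switch_symv v w x y E : switch v w x y E = switch w v y x E.
Proof.
by rewrite /switch (set2C v w) (set2C x y) (setUC [set [set v; x]]).
Qed.

Lemma switch_symx v w x y E : switch v w x y E = switch x y v w E.
Proof.
by rewrite /switch (set2C v x) (set2C w y) (setUC [set [set v; w]]).
Qed.

Definition switchable v w x y E : bool :=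
  [&& w \in nbr E v, y \in nbr E x, x \notin nbr E v, y \notin nbr E w,
      v != x & w != y].

(** Exchanging [w] and [x] reverses the switching, because both removed edges were present and both
    inserted ones absent. Injectivity in the double counting rests on this. *)
Lemma switchK v w x y E : switchable v w x y E ->
  switch v x w y (switch v w x y E) = E.
Proof.
case/and5P; rewrite !inE => vw xy vx wy _; apply/setP => e.
have e1 : (e == [set v; w]) ==> (e \in E) by apply/implyP => /eqP->.
have e2 : (e == [set x; y]) ==> (e \in E) by apply/implyP => /eqP->.
have e3 : (e == [set v; x]) ==> (e \notin E) by apply/implyP => /eqP->.
have e4 : (e == [set w; y]) ==> (e \notin E) by apply/implyP => /eqP->.
rewrite !inE; move: e1 e2 e3 e4.
by do 4!case: (e == _); case: (e \in E).
Qed.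

Lemma nbr_switch_v v w x y E : is_simple_graph E -> switchable v w x y E ->
  nbr (switch v w x y E) v = x |: (nbr E v :\ w).
Proof.
move=> sE /and5P[vw xy vx wy /andP[nvx nwy]].
have nvw : v != w by apply: contraL vw => /eqP <-; rewrite nbr_irrefl.
have nvy : v != y.
  by apply: contraNneq vx => ->; rewrite nbr_sym.
apply/setP => z; rewrite !inE !eq_set2 eqxx (negPf nvx) (negPf nvw) (negPf nvy) /=.
by rewrite !orbF andbC orbC.
Qed.

Lemma nbr_switch_out v w x y E z : z \notin [:: v; w; x; y] ->
  nbr (switch v w x y E) z = nbr E z.
Proof.
rewrite !inE !negb_or => /and4P[zv zw zx zy]; apply/setP => t.
by rewrite !inE !eq_set2 (negPf zv) (negPf zw) (negPf zx) (negPf zy) /= !orbF.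
Qed.

Lemma switchable_symv v w x y E :
  switchable v w x y E -> switchable w v y x E.
Proof.
case/and5P => vw xy vx wy /andP[nvx nwy].
by rewrite /switchable (nbr_sym E w) vw (nbr_sym E y) xy wy vx nwy nvx.
Qed.

Lemma switchable_symx v w x y E :
  switchable v w x y E -> switchable x y v w E.
Proof.
case/and5P => vw xy vx wy /andP[nvx nwy].
rewrite /switchable xy vw (nbr_sym E x) vx (nbr_sym E y) wy.
by rewrite (eq_sym x v) nvx (eq_sym y w) nwy.
Qed.

(** [v] loses [w] and gains [x]. The additive form avoids truncated subtraction, and [S] = [setT]
    gives preservation of degrees. *)
Lemma card_nbr_switch_v v w x y E S : is_simple_graph E -> switchable v w x y E ->
  #|nbr (switch v w x y E) v :&: S| + (w \in S)
    = #|nbr E v :&: S| + (x \in S).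
Proof.
move=> sE sw; rewrite (nbr_switch_v sE sw).
case/and5P: sw => vw xy vx wy /andP[nvx nwy].
have -> : (x |: nbr E v :\ w) :&: S =
    (if x \in S then [set x] else set0) :|: ((nbr E v :&: S) :\ w).
  apply/setP => z; rewrite !inE; case: eqP => [->|/eqP/negPf zx] /=.
    by case: ifP => xS; rewrite !inE ?eqxx ?xS ?andbF.
  by case: ifP; rewrite !inE ?zx ?andbA.
rewrite cardsU.
have -> : (if x \in S then [set x] else set0) :&: ((nbr E v :&: S) :\ w) = set0.
  apply/setP => z; rewrite !inE; case: ifP => _; rewrite !inE //.
  by case: eqP => [->|] //=; rewrite inE in vx; rewrite (negPf vx) andbF.
rewrite cards0 subn0 [#|nbr E v :&: S|](cardsD1 w) inE vw /=.
rewrite [LHS]addnAC [LHS]addnC; case: (x \in S); rewrite ?cards1 ?cards0 /=.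
  by rewrite addnCA [RHS]addnC [in RHS](addnC (nat_of_bool _)).
by rewrite add0n addn0 addnC.
Qed.

Variable d : 'I_n -> nat.

Lemma graphs_simple E : E \in graphs_deg d -> is_simple_graph E.
Proof. by rewrite inE => /andP[]. Qed.

Lemma card_nbr E v : E \in graphs_deg d -> #|nbr E v| = d v.
Proof.
move=> GE; rewrite -gdegE ?graphs_simple //.
by move: GE; rewrite inE => /andP[_ /forallP/(_ v)/eqP].
Qed.

Lemma switch_simple v w x y E : is_simple_graph E -> switchable v w x y E ->
  is_simple_graph (switch v w x y E).
Proof.
move=> sE /and5P[_ _ _ _ /andP[vx wy]]; apply/forall_inP => e; rewrite !inE.
case/orP => [/andP[_ /(simple_card sE)->] //|].
by case/orP => /eqP->; rewrite cards2 ?vx ?wy.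
Qed.

Lemma switch_graph v w x y E : E \in graphs_deg d -> switchable v w x y E ->
  switch v w x y E \in graphs_deg d.
Proof.
move=> GE sw; have sE := graphs_simple GE.
have sE' := switch_simple sE sw.
rewrite inE /has_degrees sE' /=; apply/forallP => z; rewrite gdegE //.
have key v' w' x' y' : switchable v' w' x' y' E ->
    #|nbr (switch v' w' x' y' E) v'| == d v'.
  move=> sw'; have := card_nbr_switch_v setT sE sw'.
  by rewrite !setIT !inE (card_nbr _ GE) => /addIn ->.
have [|zn] := boolP (z \in [:: v; w; x; y]); last first.
  by rewrite nbr_switch_out // card_nbr.
rewrite !inE => /or4P[] /eqP->; first exact: key.
- by rewrite switch_symv key // switchable_symv.
- by rewrite switch_symx key // switchable_symx.
- by rewrite switch_symx switch_symv key // switchable_symv // switchable_symx.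
Qed.

Lemma dset_leq A : dset d A <= #|A| * maxdeg d.
Proof.
by rewrite -sum_nat_const; apply: leq_sum => i _; apply: leq_bigmax.
Qed.

(** Edges are oriented, with tail in [A]: an edge inside [A] counts twice, which makes the total
    exactly a degree sum. *)
Definition darcs E A : {set 'I_n * 'I_n} := [set p | (p.1 \in A) && (p.2 \in nbr E p.1)].

Lemma card_darcs E A : E \in graphs_deg d -> #|darcs E A| = dset d A.
Proof.
move=> GE; rewrite /darcs (card_dpair A (nbr E)).
by apply: eq_bigr => x _; apply: card_nbr.
Qed.

(** Forbidden tails cost at most the degree sum of [B1]; forbidden heads cost that of [B2], after
    reversing the orientation. *)
Lemma card_good_darcs E A B1 B2 : E \in graphs_deg d ->
  dset d A <= #|[set p in darcs E A | (p.1 \notin B1) && (p.2 \notin B2)]|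
              + (dset d B1 + dset d B2).
Proof.
move=> GE; rewrite -!(card_darcs _ GE).
have -> : #|darcs E B2| = #|[set p : 'I_n * 'I_n| (p.2, p.1) \in darcs E B2]|.
  rewrite -[LHS](card_imset _ (f := fun p : 'I_n * 'I_n => (p.2, p.1))); last first.
    by move=> [a b] [a' b'] [-> ->].
  apply: eq_card => -[a b]; apply/imsetP/idP => [[[a' b'] /= H [-> ->]]|H].
    by rewrite inE.
  by exists (b, a) => //; move: H; rewrite inE.
set X := [set p in _ | _]; set Y := darcs E B1; set Z := [set p | _].
apply: (leq_trans _ (leq_trans (leq_card_setU X (Y :|: Z)).1 _)); last first.
  by rewrite leq_add2l (leq_card_setU Y Z).1.
apply: subset_leq_card; apply/fintype.subsetP => -[a b].
rewrite !inE /= => /andP[-> ab]; rewrite ab (set2C b a) ab /=.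
by case: (a \in B1); case: (b \in B2).
Qed.

(** Pairs of a graph and a forward move inject into pairs of a graph and a reverse move. Reverse
    moves are only bounded from above, so [T'] may contain triples that are not valid switchings. *)
Lemma switch_double_count v (A B : {set {set {set 'I_n}}})
    (T T' : {set {set 'I_n}} -> {set 'I_n * ('I_n * 'I_n)}) k k' :
  (forall E w x y, E \in A -> (w, (x, y)) \in T E ->
     [/\ switchable v w x y E, switch v w x y E \in B
       & (x, (w, y)) \in T' (switch v w x y E)]) ->
  (forall E, E \in A -> k <= #|T E|) ->
  (forall E, E \in B -> #|T' E| <= k') ->
  #|A| * k <= #|B| * k'.
Proof.
move=> HT Hk Hk'.
pose gph := ({set {set 'I_n}} : finType); pose tri := ('I_n * ('I_n * 'I_n))%type.
pose P (A : {set gph}) (T : gph -> {set tri}) : {set gph * tri} :=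
  [set p | (p.1 \in A) && (p.2 \in T p.1)].
have cP (A' : {set gph}) T'' : #|P A' T''| = \sum_(E in A') #|T'' E| by apply: card_dpair.
have step1 : #|A| * k <= #|P A T|.
  by rewrite cP -sum_nat_const; apply: leq_sum.
have step3 : #|P B T'| <= #|B| * k'.
  by rewrite cP -sum_nat_const; apply: leq_sum.
apply: (leq_trans step1); apply: leq_trans step3.
pose f (p : gph * tri) : gph * tri :=
  (switch v p.2.1 p.2.2.1 p.2.2.2 p.1, (p.2.2.1, (p.2.1, p.2.2.2))).
rewrite -(card_in_imset (f := f) (D := P A T)).
  apply: subset_leq_card; apply/fintype.subsetP => _ /imsetP[[E [w [x y]]] + ->].
  by rewrite !inE /= => /andP[EA tE]; case: (HT _ _ _ _ EA tE) => _ -> ->.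
move=> [E [w [x y]]] [E' [w' [x' y']]]; rewrite !inE /= => /andP[EA tE] /andP[EA' tE'].
case=> sEE ? ? ?; subst w' x' y'; congr pair.
case: (HT _ _ _ _ EA tE) => sw _ _; case: (HT _ _ _ _ EA' tE') => sw' _ _.
by rewrite -(switchK sw) sEE switchK.
Qed.

Local Notation dmax := (maxdeg d).

Lemma deg_le_maxdeg v : d v <= dmax.
Proof. exact: leq_bigmax. Qed.

(** At most D + 2 <= 3D vertices are forbidden, each of degree at most D. Forbidden heads and tails
    together give the loss 6 D^2 found below. *)
Lemma dset_nbr_bound E v U : E \in graphs_deg d -> 0 < dmax -> #|U| <= 1 ->
  dset d (v |: (nbr E v :|: U)) <= 3 * dmax ^ 2.
Proof.
move=> GE D0 U1; apply: (leq_trans (dset_leq _)).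
have : #|v |: (nbr E v :|: U)| <= 1 + (dmax + 1).
  rewrite cardsU1; apply: leq_add; first by case: (_ \notin _).
  apply: (leq_trans (leq_card_setU _ _).1); apply: leq_add => //.
  by rewrite (card_nbr _ GE) deg_le_maxdeg.
rewrite -mulnn => H; apply: (leq_trans (leq_mul H (leqnn dmax))); nia.
Qed.

(* Replacing [S] by its complement gives the opposite inequality, so nothing may
   be assumed about [v \in S] or [U \subset S]. *)
Lemma switch_ratio S v U (Q : pred {set {set 'I_n}}) b :
  0 < dmax -> #|U| <= 1 -> v \notin U ->
  (forall E E', {in U, nbr E =1 nbr E'} -> Q E -> Q E') ->
  (forall E u, Q E -> u \in U -> u \notin nbr E v) ->
  #|[set E in graphs_deg d | Q E && (#|nbr E v :&: S| == b)]|
      * ((d v - b) * (dset d S - 6 * dmax ^ 2))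
    <= #|[set E in graphs_deg d | Q E && (#|nbr E v :&: S| == b.+1)]|
      * (b.+1 * dset d (~: S)).
Proof.
move=> D0 U1 vU QE Qv; set A := [set E in _ | _]; set B := [set E in _ | _].
pose T E : {set 'I_n * ('I_n * 'I_n)} :=
  [set p | (p.1 \in nbr E v :\: S) && (p.2 \in [set q in darcs E S |
    (q.1 \notin v |: (nbr E v :|: U)) && (q.2 \notin p.1 |: (nbr E p.1 :|: U))])].
pose T' E : {set 'I_n * ('I_n * 'I_n)} :=
  [set p | (p.1 \in nbr E v :&: S) && (p.2 \in darcs E (~: S))].
apply: (@switch_double_count v A B T T').
- move=> E w x y; rewrite inE => /and3P[GE QEE /eqP XE] tE.
  rewrite !inE !negb_or /= in tE; case/andP: tE => /andP[wS vw] /andP[/andP[xS xy]].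
  move=> /andP[/and3P[xv vx xU] /and3P[yw wy yU]].
  have sw : switchable v w x y E.
    by apply/and5P; rewrite !inE; split=> //; rewrite eq_sym xv eq_sym.
  have wU : w \notin U by apply/negP => /(Qv _ _ QEE); rewrite inE vw.
  have sE := graphs_simple GE.
  split=> //.
    rewrite inE switch_graph //=; apply/andP; split.
      apply: QE QEE => u uU; rewrite nbr_switch_out // !inE !negb_or.
      by apply/and4P; split; apply: contraTneq uU => ->.
    have := card_nbr_switch_v S sE sw.
    by rewrite (negPf wS) xS XE addn0 addn1 => ->.
  have xN : x \in nbr (switch v w x y E) v.
    by rewrite (nbr_switch_v sE sw) !inE eqxx.
  have yN : y \in nbr (switch v w x y E) w.
    by rewrite switch_symv (nbr_switch_v sE (switchable_symv sw)) !inE eqxx.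
  by rewrite inE /= in_setI xN xS /= [(w, y) \in _]inE /= yN in_setC wS.
- move=> E; rewrite inE => /and3P[GE QEE /eqP XE].
  rewrite (card_dpair (nbr E v :\: S) (fun w => [set q in darcs E S |
    (q.1 \notin v |: (nbr E v :|: U)) && (q.2 \notin w |: (nbr E w :|: U))])).
  have <- : #|nbr E v :\: S| = d v - b by rewrite cardsD XE (card_nbr _ GE).
  rewrite -sum_nat_const; apply: leq_sum => w _.
  have H := card_good_darcs S (v |: (nbr E v :|: U)) (w |: (nbr E w :|: U)) GE.
  have Hv := dset_nbr_bound v GE D0 U1; have Hw := dset_nbr_bound w GE D0 U1.
  rewrite leq_subLR [leqRHS]addnC; apply: (leq_trans H); rewrite leq_add2l.
  by apply: (leq_trans (leq_add Hv Hw)); rewrite -mulnDl.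
- move=> E; rewrite inE => /and3P[GE QEE /eqP XE].
  rewrite (card_dpair (nbr E v :&: S) (fun=> darcs E (~: S))) sum_nat_const XE.
  by rewrite (card_darcs _ GE).
Qed.

(* Removing the edge [uv] lowers each of the two inner degrees by at most 1. *)
Lemma switch_adjacent S u v a b : u \in S -> v \in S -> 0 < dmax ->
  #|[set E in graphs_deg d | (u \in nbr E v) && ((#|nbr E u :&: S| == a)
       && (#|nbr E v :&: S| == b))]| * (Msum d - 6 * dmax ^ 2)
  <= #|[set E in graphs_deg d | (u \notin nbr E v) &&
       ((a.-1 <= #|nbr E u :&: S| <= a) && (b.-1 <= #|nbr E v :&: S| <= b))]|
      * (d u * d v).
Proof.
move=> uS vS D0; set A := [set E in _ | _]; set B := [set E in _ | _].
pose T E : {set 'I_n * ('I_n * 'I_n)} :=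
  [set p | (p.1 == u) && (p.2 \in [set q in darcs E setT |
    (q.1 \notin v |: (nbr E v :|: set0)) && (q.2 \notin u |: (nbr E u :|: set0))])].
pose T' E : {set 'I_n * ('I_n * 'I_n)} :=
  [set p | (p.2.1 == u) && ((p.1 \in nbr E v) && (p.2.2 \in nbr E u))].
apply: (@switch_double_count v A B T T').
- move=> E w x y; rewrite inE => /and3P[GE uv /andP[/eqP XU /eqP XV]] tE.
  rewrite !inE !orbF !negb_or /= in tE; case/andP: tE => /eqP -> /andP[xy].
  move=> /andP[/andP[xv vx] /andP[yu uy]].
  have sw : switchable v u x y E.
    by rewrite inE in uv; apply/and5P; rewrite !inE; split=> //; rewrite eq_sym xv eq_sym.
  have sE := graphs_simple GE.
  have sw2 := switchable_symv sw.
  have uv' : u != v by apply: contraTneq uv => ->; rewrite nbr_irrefl.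
  have ux' : u != x by apply: contraNneq vx => <-; rewrite inE in uv.
  split=> //.
    rewrite inE switch_graph //=; apply/and3P; split.
    + by rewrite (nbr_switch_v sE sw) !inE eqxx (negPf ux').
    (* [u] loses [v], which is in [S], and gains [y]: its inner degree stays or drops by one
       according to whether [y] is in [S]. *)
    + rewrite switch_symv; have := card_nbr_switch_v S sE sw2.
      rewrite XU vS /=; set k := #|_|; case: (y \in S) => /= H; clear -H; lia.
    + have := card_nbr_switch_v S sE sw.
      rewrite XV uS /=; set k := #|_|; case: (x \in S) => /= H; clear -H; lia.
  have xN : x \in nbr (switch v u x y E) v.
    by rewrite (nbr_switch_v sE sw) !inE eqxx.
  have yN : y \in nbr (switch v u x y E) u.
    by rewrite switch_symv (nbr_switch_v sE sw2) !inE eqxx.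
  by rewrite inE /= eqxx xN yN.
- move=> E; rewrite inE => /and3P[GE _ _].
  pose F := [set q in darcs E setT |
    (q.1 \notin v |: (nbr E v :|: set0)) && (q.2 \notin u |: (nbr E u :|: set0))].
  have -> : #|T E| = #|F|.
    rewrite -(card_imset _ (f := fun q : 'I_n * 'I_n => (u, q))); last first.
      by move=> q q' [].
    apply: eq_card => -[w q]; rewrite inE; apply/andP/imsetP => /=.
      by move=> [/eqP-> qF]; exists q.
    by move=> [q' q'F [-> ->]].
  have H := card_good_darcs setT (v |: (nbr E v :|: set0)) (u |: (nbr E u :|: set0)) GE.
  have c0 : #|(set0 : {set 'I_n})| <= 1 by rewrite cards0.
  have Hv := dset_nbr_bound v GE D0 c0; have Hu := dset_nbr_bound u GE D0 c0.
  have <- : dset d setT = Msum d by apply: eq_bigl => i; rewrite inE.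
  rewrite leq_subLR [leqRHS]addnC; apply: (leq_trans H); rewrite leq_add2l.
  by apply: (leq_trans (leq_add Hv Hu)); rewrite -mulnDl.
- move=> E; rewrite inE => /andP[GE _].
  rewrite -(card_nbr u GE) -(card_nbr v GE) mulnC -cardsX.
  rewrite -(card_in_imset (f := fun p : 'I_n * ('I_n * 'I_n) => (p.1, p.2.2))).
    apply: subset_leq_card; apply/fintype.subsetP => _ /imsetP[[x [w y]] + ->].
    by rewrite !inE /= => /and3P[_ -> ->].
  move=> [x [w y]] [x' [w' y']]; rewrite !inE /= => /and3P[/eqP-> _ _] /and3P[/eqP-> _ _].
  by case=> -> ->.
Qed.

End Switching.

(** * Sequences that nearly satisfy the binomial recursion: tails and pointwise comparison *)

Section BinomialLike.
Variable R : realType.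
Local Open Scope ring_scope.
Implicit Types (t : nat -> R) (g eps eta mu rho : R).

Definition bpmf g (d k : nat) : R := 'C(d, k)%:R * g ^+ k * (1 - g) ^+ (d - k).

(** This and [ratio_ge] bound the ratio of consecutive terms against that of Bin(d, g), from above
    and below. Cross-multiplication admits vanishing terms. *)
Definition ratio_le g eps d t := forall j, (j < d)%N ->
  (1 - g) * j.+1%:R * t j.+1 <= (1 + eps) * (g * (d - j)%:R * t j).

Definition ratio_ge g eps d t := forall j, (j < d)%N ->
  g * (d - j)%:R * t j <= (1 + eps) * ((1 - g) * j.+1%:R * t j.+1).

Lemma bpmf_ge0 g d k : 0 <= g -> g <= 1 -> 0 <= bpmf g d k.
Proof. by move=> g0 g1; rewrite !mulr_ge0 ?exprn_ge0 ?subr_ge0. Qed.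

Lemma bpmf_gt0 g d k : 0 < g -> g < 1 -> (k <= d)%N -> 0 < bpmf g d k.
Proof.
by move=> g0 g1 kd; rewrite !mulr_gt0 ?exprn_gt0 ?subr_gt0 // ltr0n bin_gt0.
Qed.

Lemma bpmf_oversize g d k : (d < k)%N -> bpmf g d k = 0.
Proof. by move=> dk; rewrite /bpmf bin_small // !mul0r. Qed.

Lemma bpmf_ratio g d j : (j < d)%N ->
  (1 - g) * j.+1%:R * bpmf g d j.+1 = g * (d - j)%:R * bpmf g d j.
Proof.
move=> jd; have E : j.+1%:R * 'C(d, j.+1)%:R = (d - j)%:R * 'C(d, j)%:R :> R.
  by rewrite -!natrM mul_bin_left.
have -> : (1 - g) * j.+1%:R * bpmf g d j.+1 =
   (j.+1%:R * 'C(d, j.+1)%:R) * (1 - g) ^+ (d - j.+1).+1 * g ^+ j.+1.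
  rewrite /bpmf (exprS (1 - g)); set a := (1 - g) ^+ _; set b := g ^+ _.
  by set c := 'C(_, _)%:R; set l := j.+1%:R; ring.
rewrite E subnSK // /bpmf (exprS g); set a := (1 - g) ^+ _; set b := g ^+ _.
by set c := 'C(_, _)%:R; set l := (d - j)%:R; ring.
Qed.

Lemma sum_bpmf g d : \sum_(0 <= k < d.+1) bpmf g d k = 1.
Proof.
rewrite big_mkord -[RHS](expr1n R d) -[in RHS](subrK g 1) exprDn.
by apply: eq_bigr => k _; rewrite /bpmf -[RHS]mulr_natl [(1 - g) ^+ _ * _]mulrC mulrA.
Qed.

Lemma binom_cdfE g d k : binom_cdf g d k = \sum_(0 <= j < k.+1) bpmf g d j.
Proof. by rewrite big_mkord. Qed.

Lemma sum_bpmf_wide g d k : (d <= k)%N -> \sum_(0 <= j < k.+1) bpmf g d j = 1.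
Proof.
move=> dk; rewrite (@big_cat_nat _ _ _ d.+1) //= sum_bpmf big_nat_cond big1 ?addr0 //.
by move=> j /andP[/andP[dj _] _]; rewrite bpmf_oversize.
Qed.

Lemma sum_bpmf_tail g d k :
  \sum_(0 <= j < k.+1) bpmf g d j = 1 - \sum_(k.+1 <= j < d.+1) bpmf g d j.
Proof.
have [dk|kd] := leqP d k; first by rewrite sum_bpmf_wide // big_geq // subr0.
rewrite -(sum_bpmf g d) [in RHS](@big_cat_nat _ _ _ k.+1) //=; last exact: ltnW.
by rewrite addrK.
Qed.

Lemma bpmf_ratio_le g d eps : 0 <= eps -> 0 <= g -> g <= 1 ->
  ratio_le g eps d (bpmf g d).
Proof.
move=> e0 g0 g1 j jd; rewrite bpmf_ratio // ler_peMl ?lerDl //.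
by rewrite mulr_ge0 ?bpmf_ge0 // mulr_ge0.
Qed.

Lemma bpmf_ratio_ge g d eps : 0 <= eps -> 0 <= g -> g <= 1 ->
  ratio_ge g eps d (bpmf g d).
Proof.
move=> e0 g0 g1 j jd; rewrite bpmf_ratio // ler_peMl ?lerDl //.
by rewrite mulr_ge0 ?bpmf_ge0 // mulr_ge0.
Qed.

Lemma geometric_right t rho k h D : 0 <= rho -> (forall j, 0 <= t j) ->
  (forall j, (k <= j)%N -> (j.+1 < D)%N -> t j.+1 <= rho * t j) ->
  \sum_(k + h <= j < D) t j <= rho ^+ h * \sum_(k <= j < D) t j.
Proof.
move=> r0 t0 Ht; elim: h => [|h IH]; first by rewrite addn0 mul1r.
rewrite exprS -mulrA; apply: le_trans (ler_wpM2l r0 IH).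
rewrite addnS big_add1 mulr_sumr.
have [kD|Dk] := ltnP (k + h) D; last by rewrite !big_geq //; lia.
rewrite -{2}(prednK (leq_ltn_trans (leq0n _) kD)) big_nat_recr /=; last by lia.
rewrite -[leLHS]addr0 lerD ?mulr_ge0 //.
by apply: ler_sum_nat => j /andP[kj jD]; apply: Ht; lia.
Qed.

Lemma geometric_left t rho k h : 0 <= rho -> (forall j, 0 <= t j) ->
  (forall j, (j.+1 < k + h)%N -> t j <= rho * t j.+1) ->
  \sum_(0 <= j < k) t j <= rho ^+ h * \sum_(0 <= j < k + h) t j.
Proof.
move=> r0 t0; elim: h => [|h IH] Ht; first by rewrite addn0 mul1r.
apply: (le_trans (IH _)); first by move=> j jk; apply: Ht; lia.
rewrite exprSr -mulrA ler_wpM2l ?exprn_ge0 // addnS.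
rewrite big_nat_recl //= mulrDr -[leLHS]add0r lerD ?mulr_ge0 // mulr_sumr.
by apply: ler_sum_nat => j /andP[_ jD]; apply: Ht; lia.
Qed.

Lemma sum_nat_subrange t k l D : (forall j, 0 <= t j) -> (l <= D)%N ->
  \sum_(k <= j < l) t j <= \sum_(0 <= j < D) t j.
Proof.
move=> t0 lD; have [kl|lk] := leqP k l; last by rewrite big_geq ?sumr_ge0 // ltnW.
rewrite (@big_cat_nat _ _ _ l 0 D) //= (@big_cat_nat _ _ _ k 0 l) //=.
by rewrite -addrA addrCA lerDl addr_ge0 ?sumr_ge0.
Qed.

(** For j >= (1 + eta) mu >= g d one has d - j <= (1 - g) d, so t_(j+1)/t_j is at most (1 + eps)/(1
    + eta) <= exp(-eta/2). At least eta mu - 1 such steps lie below (1 + 2 eta) mu. Since [mu] only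
    has to dominate the mean g d, one [mu] can serve all vertices of small degree. *)
Lemma upper_tail g eps eta mu d t k :
  0 < g -> g < 1 -> g * d%:R <= mu -> 0 < eta -> eta <= 2^-1 ->
  0 <= eps -> eps <= eta / 4 -> (forall j, 0 <= t j) -> ratio_le g eps d t ->
  (1 + 2 * eta) * mu <= k%:R ->
  \sum_(k <= j < d.+1) t j
    <= expR (- (eta / 2 * (eta * mu - 1))) * \sum_(0 <= j < d.+1) t j.
Proof.
move=> g0 g1 gd eta0 eta1 eps0 eps1 t0 Ht Hk.
have mu0 : 0 <= mu by apply: le_trans gd; rewrite mulr_ge0 // ltW.
have sum0 : 0 <= \sum_(0 <= j < d.+1) t j by apply: sumr_ge0.
set j0 := (Num.trunc ((1 + eta) * mu)).+1.
have em0 : 0 <= eta * mu by rewrite mulr_ge0 // ltW.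
have /Num.Theory.truncn_itv/andP[j0l j0u] : 0 <= (1 + eta) * mu by lra.
have {}j0l : j0%:R <= (1 + eta) * mu + 1 by rewrite /j0 -natr1 lerD2r.
have {}j0u : (1 + eta) * mu < j0%:R := j0u.
(* In this case eta mu <= 1, so the claimed factor is at least 1. *)
have [kj|jk] := ltnP k j0.
  apply: (le_trans (sum_nat_subrange k t0 (leqnn _))).
  rewrite -[leLHS]mul1r ler_wpM2r // -[X in X <= _]expR0 ler_expR.
  have : (k.+1%:R <= j0%:R :> R) by rewrite ler_nat.
  rewrite -natr1 => kj1; have em1 : eta * mu <= 1 by lra.
  have e2 : 0 <= eta / 2 by lra.
  have e3 : eta * mu - 1 <= 0 by lra.
  by rewrite oppr_ge0 mulr_ge0_le0.
set rho := (1 + eps) / (1 + eta).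
have rho0 : 0 <= rho by rewrite divr_ge0; lra.
have Hrho : rho <= expR (- (eta / 2)).
  apply: le_trans (expR_ge1Dx _); rewrite /rho ler_pdivrMr; last by lra.
  have : eta * eta <= eta * 2^-1 by rewrite ler_pM2l.
  by lra.
have -> : k = (j0 + (k - j0))%N by rewrite subnKC.
apply: (le_trans (geometric_right _ rho0 t0 _)).
  move=> j jj jd; rewrite ltnS in jd.
  have j0j : j0%:R <= j%:R :> R by rewrite ler_nat.
  have jd' : j%:R + 1 <= d%:R :> R by rewrite natr1 ler_nat.
  have := Ht j jd; rewrite natrB ?(ltnW jd) // -natr1 => H.
  have tj := t0 j; have tj1 := t0 j.+1.
  have J : (1 + eta) * mu <= j%:R by lra.
  have gj : g * d%:R <= j%:R by lra.
  rewrite /rho mulrAC ler_pdivlMr; last by lra.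
  have A : (1 - g) * ((j%:R + 1) * t j.+1) <= (1 - g) * ((1 + eps) * (mu * t j)).
    have dg : d%:R - j%:R <= (1 - g) * d%:R by lra.
    have : g * (d%:R - j%:R) * t j <= (1 - g) * mu * t j.
      apply: ler_wpM2r => //; have := ler_wpM2l (ltW g0) dg.
      have := ler_wpM2l (_ : 0 <= 1 - g) gd; rewrite subr_ge0 (ltW g1) => /(_ isT).
      by lra.
    move=> H1; have e1 : 0 <= 1 + eps by lra.
    by have := ler_wpM2l e1 H1; lra.
  have {A} : (j%:R + 1) * t j.+1 <= (1 + eps) * (mu * t j).
    by move: A; rewrite ler_pM2l // subr_gt0.
  have : (1 + eta) * mu * t j.+1 <= (j%:R + 1) * t j.+1 by apply: ler_wpM2r => //; lra.
  (* The ratio bound is obtained by cancelling [mu]; when [mu] is 0 the recursion itself forces the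
     next term to vanish. *)
  have [->|mup] : mu = 0 \/ 0 < mu by move: mu0; rewrite le_eqVlt => /orP[/eqP<-|]; auto.
    rewrite mul0r !mulr0 => _ H1.
    have tz : t j.+1 <= 0.
      have : 0 < j%:R + 1 :> R by rewrite natr1.
      by move=> jp; rewrite -(pmulr_rle0 _ jp).
    have tz' : t j.+1 = 0 by lra.
    by rewrite tz' mul0r mulr_ge0 //; lra.
  move=> H1 H2; rewrite -(ler_pM2l mup); lra.
apply: ler_pM; rewrite ?exprn_ge0 ?sumr_ge0 //; last exact: sum_nat_subrange.
apply: (le_trans (lerXn2r _ _ _ Hrho)); rewrite ?nnegrE ?expR_ge0 //.
rewrite -expRM_natl ler_expR natrB // mulrN lerN2 mulrC ler_wpM2r; lra.
Qed.

(** Mirror image: for j < (1 - eta) mu one has d - j >= (1 - g) d, so descending by one multiplies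
    by at most (1 + eps)(1 - eta) <= exp(-eta/2). The window of length [h] above [k] still ends
    below (1 - eta) mu. *)
Lemma lower_tail g eps eta mu d t k :
  0 < g -> g < 1 -> 0 <= mu -> mu <= g * d%:R -> 0 < eta -> eta <= 2^-1 ->
  0 <= eps -> eps <= eta / 4 -> (forall j, 0 <= t j) -> ratio_ge g eps d t ->
  k%:R <= (1 - 2 * eta) * mu ->
  \sum_(0 <= j < k.+1) t j
    <= expR (- (eta / 2 * (eta * mu - 1))) * \sum_(0 <= j < d.+1) t j.
Proof.
move=> g0 g1 mu0 gd eta0 eta1 eps0 eps1 t0 Ht Hk.
set h := Num.trunc (eta * mu).
have /andP[hl hu] := Num.Theory.truncn_itv (mulr_ge0 (ltW eta0) mu0).
rewrite -/h in hl hu.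
have em0 : 0 <= eta * mu by rewrite mulr_ge0 // ltW.
set rho := (1 + eps) * (1 - eta).
have rho0 : 0 <= rho by rewrite mulr_ge0; lra.
have Hrho : rho <= expR (- (eta / 2)).
  apply: le_trans (expR_ge1Dx _); rewrite /rho.
  have : 0 <= eps * eta by rewrite mulr_ge0 // ltW.
  by lra.
have khmu : (k + h)%:R <= (1 - eta) * mu by rewrite natrD; lra.
have d0 : 0 <= d%:R :> R by [].
have khd : (k + h <= d)%N.
  rewrite -(ler_nat R); apply: (le_trans khmu).
  have : g * d%:R <= 1 * d%:R by rewrite ler_wpM2r // ltW.
  by lra.
apply: (le_trans (geometric_left (rho := rho) (h := h) rho0 t0 _)).
  move=> j; rewrite addSn ltnS => jkh.
  have jd : (j < d)%N := leq_trans jkh khd.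
  have jmu : j.+1%:R <= (1 - eta) * mu by apply: le_trans khmu; rewrite ler_nat.
  have := Ht j jd; rewrite natrB ?(ltnW jd) // => H.
  have jmu' : j%:R + 1 <= (1 - eta) * mu by rewrite natr1.
  have tj := t0 j; have tj1 := t0 j.+1.
  have dp : 0 < d%:R :> R by rewrite ltr0n (leq_ltn_trans _ jd).
  have j0 : 0 <= j%:R :> R by [].
  have A : (1 - g) * (g * d%:R * t j) <= g * (d%:R - j%:R) * t j.
    have : (1 - g) * d%:R <= d%:R - j%:R by lra.
    move=> H1; rewrite [leLHS](_ : _ = g * ((1 - g) * d%:R) * t j); last by ring.
    by rewrite ler_wpM2r // ler_wpM2l // ltW.
  have B : (1 + eps) * ((1 - g) * j.+1%:R * t j.+1)
        <= (1 - g) * ((1 + eps) * ((1 - eta) * (g * d%:R)) * t j.+1).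
    rewrite [leLHS](_ : _ = (1 - g) * ((1 + eps) * j.+1%:R * t j.+1)); last by ring.
    rewrite ler_wpM2l ?ler_wpM2r ?ler_wpM2l ?subr_ge0 ?(ltW g1) //; first by lra.
    by apply: (le_trans jmu); rewrite ler_wpM2l //; lra.
  have := le_trans A (le_trans H B); rewrite ler_pM2l ?subr_gt0 //.
  rewrite [leRHS](_ : _ = g * d%:R * (rho * t j.+1)); last by rewrite /rho; ring.
  by rewrite ler_pM2l // mulr_gt0.
apply: ler_pM; rewrite ?exprn_ge0 ?sumr_ge0 //; last first.
  by apply: sum_nat_subrange; rewrite // addSn ltnS.
apply: (le_trans (lerXn2r _ _ _ Hrho)); rewrite ?nnegrE ?expR_ge0 //.
rewrite -expRM_natl ler_expR mulrN lerN2 mulrC ler_wpM2r; rewrite -natr1 in hu; lra.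
Qed.

(** The quotient t_i / bpmf_i changes by a factor at most 1 + eps, up or down, at each step, and [j]
    and [k] are at most [d] steps apart. Summing this form over [j] normalises both sides and gives
    the two bounds that follow. *)
Lemma compare_bpmf g eps d t j k : 0 < g -> g < 1 -> 0 <= eps ->
  (forall j, 0 <= t j) -> ratio_le g eps d t -> ratio_ge g eps d t ->
  (j <= d)%N -> (k <= d)%N ->
  t k * bpmf g d j <= (1 + eps) ^+ d * (t j * bpmf g d k).
Proof.
move=> g0 g1 e0 t0 Hle Hge jd kd.
have p0 i : (i <= d)%N -> 0 < bpmf g d i by move=> id; apply: bpmf_gt0.
pose u i := t i / bpmf g d i.
have u0 i : 0 <= u i by rewrite divr_ge0 ?bpmf_ge0 ?(ltW g0) ?(ltW g1).
have up i : (i < d)%N -> u i.+1 <= (1 + eps) * u i.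
  move=> id; rewrite /u ler_pdivrMr ?p0 //.
  rewrite [leRHS](_ : _ = (1 + eps) * t i * bpmf g d i.+1 / bpmf g d i); last by ring.
  rewrite ler_pdivlMr ?p0 1?ltnW //.
  have c0 : 0 < (1 - g) * i.+1%:R by rewrite mulr_gt0 ?subr_gt0.
  rewrite -(ler_pM2l c0) mulrA.
  apply: (le_trans (ler_wpM2r (ltW (p0 _ (ltnW id))) (Hle _ id))).
  rewrite [leRHS](_ : _ = (1 + eps) * t i * ((1 - g) * i.+1%:R * bpmf g d i.+1)); last by ring.
  by rewrite bpmf_ratio // le_eqVlt; apply/orP; left; apply/eqP; ring.
have dn i : (i < d)%N -> u i <= (1 + eps) * u i.+1.
  move=> id; rewrite /u ler_pdivrMr ?p0 1?ltnW //.
  rewrite [leRHS](_ : _ = (1 + eps) * t i.+1 * bpmf g d i / bpmf g d i.+1); last by ring.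
  rewrite ler_pdivlMr ?p0 //.
  have c0 : 0 < (1 - g) * i.+1%:R by rewrite mulr_gt0 ?subr_gt0.
  rewrite -(ler_pM2l c0).
  rewrite [leLHS](_ : _ = t i * ((1 - g) * i.+1%:R * bpmf g d i.+1)); last by ring.
  rewrite bpmf_ratio // [leLHS](_ : _ = g * (d - i)%:R * t i * bpmf g d i); last by ring.
  apply: (le_trans (ler_wpM2r (ltW (p0 _ (ltnW id))) (Hge _ id))).
  by rewrite le_eqVlt; apply/orP; left; apply/eqP; ring.
have e1 : 1 <= 1 + eps by lra.
have e1' : 0 <= 1 + eps by lra.
have upn i h : (i + h <= d)%N -> u (i + h)%N <= (1 + eps) ^+ h * u i.
  elim: h => [|h IH] H; first by rewrite addn0 mul1r.
  rewrite addnS; apply: (le_trans (up _ _)); first by lia.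
  by rewrite exprS -mulrA ler_wpM2l // IH //; lia.
have dnn i h : (i + h <= d)%N -> u i <= (1 + eps) ^+ h * u (i + h)%N.
  elim: h => [|h IH] H; first by rewrite addn0 mul1r.
  apply: (le_trans (IH _)); first by lia.
  rewrite exprSr -mulrA ler_wpM2l ?exprn_ge0 // addnS; apply: dn; lia.
have key : u k <= (1 + eps) ^+ d * u j.
  have [kj|jk] := leqP k j.
    apply: (le_trans (dnn k (j - k)%N _)); first by lia.
    by rewrite subnKC // ler_wpM2r // ler_weXn2l //; lia.
  have := upn j (k - j)%N; rewrite (subnKC (ltnW jk)) => /(_ kd) H.
  by apply: (le_trans H); rewrite ler_wpM2r // ler_weXn2l //; lia.
move: key; rewrite /u ler_pdivrMr ?p0 // => key.
rewrite -ler_pdivlMr ?p0 //; apply: (le_trans key).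
by rewrite le_eqVlt; apply/orP; left; apply/eqP; ring.
Qed.

Lemma bpmf_upper g eps d t k : 0 < g -> g < 1 -> 0 <= eps ->
  (forall j, 0 <= t j) -> ratio_le g eps d t -> ratio_ge g eps d t ->
  (k <= d)%N ->
  t k <= (1 + eps) ^+ d * (bpmf g d k * \sum_(0 <= j < d.+1) t j).
Proof.
move=> g0 g1 e0 t0 Hle Hge kd.
rewrite -[leLHS]mulr1 -[X in _ * X <= _](sum_bpmf g d) !mulr_sumr.
apply: ler_sum_nat => j /andP[_ jd].
by rewrite [_ * t j]mulrC; apply: compare_bpmf.
Qed.

Lemma bpmf_lower g eps d t k : 0 < g -> g < 1 -> 0 <= eps ->
  (forall j, 0 <= t j) -> ratio_le g eps d t -> ratio_ge g eps d t ->
  (k <= d)%N ->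
  bpmf g d k * \sum_(0 <= j < d.+1) t j <= (1 + eps) ^+ d * t k.
Proof.
move=> g0 g1 e0 t0 Hle Hge kd.
rewrite -[t k]mulr1 -[X in _ <= _ * (_ * X)](sum_bpmf g d) !mulr_sumr.
apply: ler_sum_nat => j /andP[_ jd].
by rewrite mulrC; apply: compare_bpmf.
Qed.

End BinomialLike.

(** * The non-decreasing sequence with a prescribed cumulative count *)

Section Levels.
Local Open Scope nat_scope.
Variable N : nat -> nat.
Hypothesis monoN : forall i j, i <= j -> N i <= N j.

Definition step k := N k - (if k is k'.+1 then N k' else 0).

(** [dHseq] unfolds to this with [N] := [Nfun]. The entry at index [k] is the least [m] with k < N
    m, a quantile of [N]; the lemmas below give each direction. *)
Definition levels D := flatten [seq nseq (step k) k | k <- iota 0 D.+1].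

Lemma levelsS D : levels D.+1 = levels D ++ nseq (N D.+1 - N D) D.+1.
Proof.
by rewrite /levels -[in LHS]addn1 iotaD map_cat flatten_cat /= cats0 add0n.
Qed.

Lemma size_levels D : size (levels D) = N D.
Proof.
elim: D => [|D IH]; first by rewrite /levels /= cats0 size_nseq /step subn0.
by rewrite levelsS size_cat IH size_nseq subnKC // monoN.
Qed.

Lemma nth_levels_le D k m : k < N m -> nth 0 (levels D) k <= m.
Proof.
move=> km; elim: D => [|D IH]; first by rewrite /levels /= cats0 nth_nseq; case: ifP.
rewrite levelsS nth_cat size_levels; case: ltnP => // kD.
rewrite nth_nseq; case: ifP => // _; rewrite ltnNge; apply/negP => mD.
by have := leq_trans km (leq_trans (monoN mD) kD); rewrite ltnn.
Qed.

Lemma nth_levels_gt D k m : N m <= k -> k < N D -> m < nth 0 (levels D) k.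
Proof.
move=> mk kD; elim: D kD => [|D IH] kD.
  by have := leq_trans kD (leq_trans (monoN (leq0n m)) mk); rewrite ltnn.
rewrite levelsS nth_cat size_levels; case: (ltnP k (N D)) => kD'; first exact: IH.
rewrite nth_nseq ltn_sub2r //; last exact: leq_ltn_trans kD' kD.
rewrite ltnNge; apply/negP => mD.
by have := leq_trans kD (leq_trans (monoN mD) mk); rewrite ltnn.
Qed.

Lemma count_levels D i : count (pred1 i) (levels D) = (i <= D) * step i.
Proof.
elim: D => [|D IH].
  rewrite /levels /= cats0 count_nseq /= leqn0.
  by rewrite eq_sym; case: eqP => // ->.
rewrite levelsS count_cat IH count_nseq /= [i <= D.+1]leq_eqVlt ltnS eq_sym.
by case: eqP => [->|_] /=; rewrite ?ltnn ?addn0.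
Qed.

End Levels.

(** * Locating the entries and the counts of d_H *)

Section ModelDegrees.
Import mathcomp.boot.finset.
Local Open Scope ring_scope.
Variables (R : realType) (n : nat) (d : 'I_n -> nat) (S : {set 'I_n}).
Hypothesis gam0 : 0 < (gam d S : R).
Hypothesis gam1 : (gam d S : R) < 1.

Notation g := (gam d S : R).
Notation N := (Nfun (R:=R) d S).

Definition cdf_sum k : R := \sum_(i in S) binom_cdf g (d i) k.

Lemma cdf_sum_ge0 k : 0 <= cdf_sum k.
Proof.
apply: sumr_ge0 => i _; rewrite binom_cdfE sumr_ge0 // => j _.
by rewrite bpmf_ge0 ?(ltW gam0) ?(ltW gam1).
Qed.

Lemma Nfun_floor k : (N k)%:R = (Num.floor (cdf_sum k + 2^-1))%:~R :> R.
Proof.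
have f0 : (0 <= Num.floor (cdf_sum k + 2^-1 : R))%R.
  by rewrite floor_ge0 addr_ge0 ?cdf_sum_ge0 // invr_ge0.
by rewrite /Nfun -[in RHS](gez0_abs f0).
Qed.

Lemma Nfun_le k : (N k)%:R <= cdf_sum k + 2^-1.
Proof. by rewrite Nfun_floor floor_le_tmp. Qed.

Lemma Nfun_gt k : cdf_sum k - 2^-1 < (N k)%:R.
Proof.
have := lt_succ_floor (cdf_sum k + 2^-1 : R).
by rewrite Nfun_floor intrD; lra.
Qed.

Lemma binom_cdfS (x : R) j k : binom_cdf x j k.+1 = binom_cdf x j k + bpmf x j k.+1.
Proof. by rewrite !binom_cdfE big_nat_recr. Qed.

Lemma cdf_sumS k : cdf_sum k.+1 = cdf_sum k + \sum_(i in S) bpmf g (d i) k.+1.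
Proof. by rewrite /cdf_sum -big_split /=; apply: eq_bigr => i _; rewrite binom_cdfS. Qed.

Lemma Nfun_mono i j : (i <= j)%N -> (N i <= N j)%N.
Proof.
move=> ij; rewrite -(ler_nat R) !Nfun_floor ler_int le_floor // lerD2r.
elim: j ij => [|j IH]; first by rewrite leqn0 => /eqP->.
rewrite leq_eqVlt => /orP[/eqP-> //|/IH H]; apply: (le_trans H).
rewrite cdf_sumS lerDl sumr_ge0 // => k _.
by rewrite bpmf_ge0 ?(ltW gam0) ?(ltW gam1).
Qed.

Lemma Nfun_maxdeg : N (maxdeg d) = #|S|.
Proof.
have E : cdf_sum (maxdeg d) = #|S|%:R.
  rewrite /cdf_sum -sum1_card natr_sum; apply: eq_bigr => i _.
  by rewrite binom_cdfE sum_bpmf_wide //; apply: leq_bigmax.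
have := Nfun_le (maxdeg d); have := Nfun_gt (maxdeg d); rewrite E => H1 H2.
have L : (N (maxdeg d) < #|S|.+1)%N by rewrite -(ltr_nat R) -natr1; lra.
have L' : (#|S| < (N (maxdeg d)).+1)%N by rewrite -(ltr_nat R) -natr1; lra.
by apply/eqP; rewrite eqn_leq; apply/andP.
Qed.

Lemma dHseqE : dHseq (R:=R) d S = levels N (maxdeg d).
Proof. by []. Qed.

(** The count is a difference of two rounded sums, each off by at most 1/2. *)
Lemma nk_dHseq i :
  `|(nk (dHseq (R:=R) d S) i)%:R - \sum_(v in S) bpmf g (d v) i| <= 1.
Proof.
rewrite dHseqE /nk count_levels; have [iD|Di] := leqP i (maxdeg d); last first.
  rewrite big1 ?subr0 ?normr0 // => v _; apply: bpmf_oversize.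
  by apply: leq_ltn_trans Di; apply: leq_bigmax.
rewrite mul1n; case: i iD => [|i] iD; rewrite /step.
  have := Nfun_le 0; have := Nfun_gt 0.
  have -> : cdf_sum 0 = \sum_(v in S) bpmf g (d v) 0.
    by apply: eq_bigr => v _; rewrite binom_cdfE big_nat1.
  by rewrite subn0 ler_norml => ? ?; lra.
rewrite natrB; last by apply: Nfun_mono.
have := Nfun_le i; have := Nfun_gt i.
have := Nfun_le i.+1; have := Nfun_gt i.+1.
by rewrite cdf_sumS ler_norml => ? ? ? ?; lra.
Qed.

Lemma iS_leq (j k : 'I_#|S|) : (j <= k)%N -> (iS j <= iS k)%N.
Proof.
move=> jk; rewrite /iS.
have s_ord : sorted (relpre val ltn) (enum 'I_n).
  by rewrite -sorted_map val_enum_ord iota_ltn_sorted.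
have tr : transitive (relpre (val : 'I_n -> nat) ltn) by move=> x y z; apply: ltn_trans.
have sS : sorted (relpre val ltn) (enum S).
  have -> : enum S = [seq x <- enum 'I_n | x \in S].
    by rewrite enumT; apply: eq_filter.
  exact: sorted_filter.
move: jk; rewrite leq_eqVlt => /orP[/eqP/val_inj-> //|jk].
apply: ltnW; have x0 : 'I_n := enum_val j.
have := sorted_ltn_nth tr x0 sS; rewrite /prop_in2 => /(_ j k).
rewrite !inE -cardE !ltn_ord => /(_ isT isT jk) /=.
by rewrite !(enum_val_nth x0).
Qed.

Lemma cdf_sum_enum k : cdf_sum k = \sum_(j < #|S|) binom_cdf g (d (iS j)) k.
Proof. by rewrite /cdf_sum big_enum_val. Qed.

(** The first k + 1 vertices contribute at least k + 1 - |S| theta > k + 1/2 to the cumulative sum,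
    and rounding loses at most another 1/2, so k < N(m). *)
Lemma dHseq_le (theta : R) (k : 'I_#|S|) m : 0 <= theta ->
  #|S|%:R * theta < 2^-1 ->
  (forall j : 'I_#|S|, (j <= k)%N -> 1 - theta <= binom_cdf g (d (iS j)) m) ->
  (nth 0%N (dHseq (R:=R) d S) k <= m)%N.
Proof.
move=> th0 Sth Hk; rewrite dHseqE; apply: nth_levels_le; first exact: Nfun_mono.
rewrite -(ltr_nat R); apply: le_lt_trans (Nfun_gt m).
suff : k.+1%:R * (1 - theta) <= cdf_sum m.
  have : k.+1%:R * theta <= #|S|%:R * theta by rewrite ler_wpM2r // ler_nat.
  by rewrite -natr1; lra.
have -> : k.+1%:R * (1 - theta) = \sum_(j < #|S| | (j <= k)%N) (1 - theta).
  rewrite sumr_const -[RHS]mulr_natl; congr (_%:R * _).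
  rewrite -[RHS]sum1_card (eq_bigl (fun j : 'I_#|S| => (j < k.+1)%N)) //.
  by rewrite -(big_ord_widen _ (fun=> 1%N)) // sum1_card card_ord.
rewrite cdf_sum_enum [leRHS](bigID (fun j : 'I_#|S| => (j <= k)%N)) /=.
rewrite -[leLHS]addr0; apply: lerD; first by apply: ler_sum.
apply: sumr_ge0 => i _; rewrite binom_cdfE sumr_ge0 // => j _.
by rewrite bpmf_ge0 ?(ltW gam0) ?(ltW gam1).
Qed.

Lemma binom_cdf_le1 v m : binom_cdf g (d v) m <= 1.
Proof.
rewrite binom_cdfE sum_bpmf_tail lerBlDr lerDl sumr_ge0 // => j _.
by rewrite bpmf_ge0 ?(ltW gam0) ?(ltW gam1).
Qed.

(** Vertices before [k] contribute at most 1 each and the others at most [theta], so the sum is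
    below k + 1/2 and its rounding is at most k. *)
Lemma dHseq_gt (theta : R) (k : 'I_#|S|) m : 0 <= theta ->
  #|S|%:R * theta < 2^-1 ->
  (forall j : 'I_#|S|, (k <= j)%N -> binom_cdf g (d (iS j)) m <= theta) ->
  (m < nth 0%N (dHseq (R:=R) d S) k)%N.
Proof.
move=> th0 Sth Hk; rewrite dHseqE; apply: nth_levels_gt; first exact: Nfun_mono.
  rewrite -ltnS -(ltr_nat R); apply: le_lt_trans (Nfun_le m) _.
  suff : cdf_sum m <= k%:R + #|S|%:R * theta.
    by have -> : k.+1%:R = k%:R + 1 :> R; [rewrite natr1 | move=> ?; lra].
  rewrite cdf_sum_enum (bigID (fun j : 'I_#|S| => (j < k)%N)) /=; apply: lerD.
    apply: (@le_trans _ _ (\sum_(j < #|S| | (j < k)%N) 1)).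
      by apply: ler_sum => j _; apply: binom_cdf_le1.
    rewrite -(big_ord_widen _ (fun=> 1)) 1?ltnW //.
    by rewrite sumr_const card_ord.
  apply: (@le_trans _ _ (\sum_(j < #|S| | ~~ (j < k)%N) theta)).
    by apply: ler_sum => j; rewrite -leqNgt; apply: Hk.
  rewrite sumr_const -[X in X <= _]mulr_natl ler_wpM2r // ler_nat.
  by apply: leq_trans (max_card _) _; rewrite card_ord.
by rewrite Nfun_maxdeg.
Qed.

End ModelDegrees.

(** * Union bound and second moment method for counts *)

Section Counting.
Import mathcomp.boot.finset.
Local Open Scope ring_scope.
Variable R : realType.

Lemma card_setIdE (G : finType) (Om : {set G}) (P : pred G) :
  #|[set E in Om | P E]|%:R = \sum_(E in Om) (P E)%:R :> R.
Proof.
rewrite -sum1_card natr_sum big_mkcond [RHS]big_mkcond /=; apply: eq_bigr => E _.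
by rewrite inE; case: (E \in Om); case: (P E).
Qed.

Lemma card_setId_le (G : finType) (Om : {set G}) (P Q : pred G) :
  (forall E, E \in Om -> P E -> Q E) ->
  #|[set E in Om | P E]|%:R <= #|[set E in Om | Q E]|%:R :> R.
Proof.
move=> PQ; rewrite ler_nat; apply: subset_leq_card; apply/fintype.subsetP => E.
by rewrite !inE => /andP[EO PE]; rewrite EO PQ.
Qed.

Lemma card_setIdU_le (G : finType) (Om : {set G}) (P Q : pred G) :
  #|[set E in Om | P E || Q E]|%:R
    <= #|[set E in Om | P E]|%:R + #|[set E in Om | Q E]|%:R :> R.
Proof.
rewrite !card_setIdE -big_split /=; apply: ler_sum => E _.
by case: (P E); case: (Q E); rewrite /= ?addr0 ?add0r // lerDl.
Qed.

Lemma card_setId_exists_le (G I : finType) (Om : {set G}) (A : {set I}) (P : I -> pred G) :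
  #|[set E in Om | [exists v in A, P v E]]|%:R
    <= \sum_(v in A) #|[set E in Om | P v E]|%:R :> R.
Proof.
rewrite card_setIdE; under [leRHS]eq_bigr do rewrite card_setIdE.
rewrite exchange_big /=; apply: ler_sum => E _.
case: existsP => [[v /andP[vA Pv]]|_] /=; last by apply: sumr_ge0.
by rewrite (bigD1 v) //= Pv lerDl sumr_ge0.
Qed.

Lemma sum_indicator (x k D : nat) :
  \sum_(k <= j < D) (x == j)%:R = (k <= x < D)%N%:R :> R.
Proof.
transitivity (\sum_(k <= j < D | j == x) 1 : R).
  by rewrite [RHS]big_mkcond; apply: eq_bigr => j _; rewrite eq_sym; case: eqP.
by rewrite big_nat1_eq; case: ifP.
Qed.

(** The factor 3 kappa adds kappa from the off-diagonal second moment and 2 kappa from the cross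
    term -2 mu Y, where the lower bounds on single events enter. Joint events need an upper bound
    only. *)
Lemma chebyshev_count (G I : finType) (Om : {set G}) (T : {set I})
    (A : I -> pred G) (p : I -> R) (kappa b : R) :
  let W := #|Om|%:R : R in
  let mu := \sum_(v in T) p v in
  0 <= kappa -> 0 < b -> (forall v, v \in T -> 0 <= p v) ->
  (forall v, v \in T -> (1 - kappa) * p v * W <= #|[set E in Om | A v E]|%:R) ->
  (forall v, v \in T -> #|[set E in Om | A v E]|%:R <= (1 + kappa) * p v * W) ->
  (forall u v, u \in T -> v \in T -> u != v ->
     #|[set E in Om | A u E && A v E]|%:R <= (1 + kappa) * (p u * p v) * W) ->
  #|[set E in Om | b < `|\sum_(v in T) (A v E)%:R - mu| ]|%:R * b ^+ 2
    <= ((1 + kappa) * mu + 3 * kappa * mu ^+ 2) * W.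
Proof.
move=> W mu k0 b0 p0 Hlo Hup Hjoint.
have mu0 : 0 <= mu by apply: sumr_ge0.
have W0 : 0 <= W by [].
pose Y E : R := \sum_(v in T) (A v E)%:R.
pose q v : R := #|[set E in Om | A v E]|%:R.
apply: (@le_trans _ _ (\sum_(E in Om) (Y E - mu) ^+ 2)).
  rewrite card_setIdE mulr_suml; apply: ler_sum => E _.
  case: ltP => H; last by rewrite mul0r sqr_ge0.
  rewrite mul1r -[leRHS]real_normK ?num_real // ler_sqr ?nnegrE ?normr_ge0 ?(ltW b0) //.
  exact: ltW.
have sumY : \sum_(E in Om) Y E = \sum_(v in T) q v.
  by rewrite exchange_big /=; apply: eq_bigr => v _; rewrite /q card_setIdE.
have sumY2 : \sum_(E in Om) Y E ^+ 2 <= \sum_(v in T) q v + (1 + kappa) * mu ^+ 2 * W.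
  have -> : \sum_(E in Om) Y E ^+ 2 =
      \sum_(u in T) \sum_(v in T) #|[set E in Om | A u E && A v E]|%:R.
    under eq_bigr do rewrite expr2 /Y mulr_suml.
    rewrite exchange_big /=; apply: eq_bigr => u _.
    under eq_bigr do rewrite mulr_sumr.
    rewrite exchange_big /=; apply: eq_bigr => v _.
    rewrite card_setIdE; apply: eq_bigr => E _.
    by case: (A u E); rewrite ?mul1r ?mul0r.
  have -> : (1 + kappa) * mu ^+ 2 * W =
      \sum_(u in T) \sum_(v in T) (1 + kappa) * (p u * p v) * W.
    rewrite expr2 {1}/mu mulr_suml mulr_sumr mulr_suml; apply: eq_bigr => u _.
    by rewrite /mu mulr_sumr mulr_sumr mulr_suml.
  rewrite -big_split /=; apply: ler_sum => u uT.
  rewrite (bigD1 u) //= [X in _ <= _ + X](bigD1 u) //= addrA; apply: lerD.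
    rewrite -[leLHS]addr0 lerD ?mulr_ge0 ?p0 //; last by lra.
    by rewrite /q; apply: card_setId_le => E _ /andP[].
  by apply: ler_sum => v /andP[vT vu]; rewrite Hjoint // eq_sym.
have -> : \sum_(E in Om) (Y E - mu) ^+ 2 =
    \sum_(E in Om) Y E ^+ 2 - 2 * mu * \sum_(E in Om) Y E + mu ^+ 2 * W.
  rewrite mulr_sumr -sumrB.
  have -> : mu ^+ 2 * W = \sum_(E in Om) mu ^+ 2 by rewrite sumr_const mulr_natr.
  by rewrite -big_split /=; apply: eq_bigr => E _; ring.
have slo : (1 - kappa) * mu * W <= \sum_(v in T) q v.
  by rewrite mulr_sumr mulr_suml; apply: ler_sum => v vT; apply: Hlo.
have sup : \sum_(v in T) q v <= (1 + kappa) * mu * W.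
  by rewrite mulr_sumr mulr_suml; apply: ler_sum => v vT; apply: Hup.
rewrite sumY; have m2 : 0 <= 2 * mu by lra.
have := ler_wpM2l m2 slo; lra.
Qed.

End Counting.

(** * Laws of one and of two inner degrees *)

Section InnerDegrees.
Import mathcomp.boot.finset.
Local Open Scope ring_scope.
Variables (R : realType) (n : nat) (d : 'I_n -> nat) (S : {set 'I_n}) (eps : R).
Notation g := (gam d S : R).
Notation Om := (graphs_deg d).
Notation D := (maxdeg d).
Notation W := (#|Om|%:R : R).
Notation X E v := #|nbr E v :&: S|.

Hypothesis D0 : (0 < D)%N.
Hypothesis gam0 : 0 < g.
Hypothesis gam1 : g < 1.
Hypothesis M0 : (0 < Msum d)%N.
Hypothesis eps0 : 0 <= eps.
Hypothesis epsS :
  (dset d S)%:R <= (1 + eps) * ((dset d S)%:R - 6 * D%:R ^+ 2).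
Hypothesis epsSC :
  (dset d (~: S))%:R <= (1 + eps) * ((dset d (~: S))%:R - 6 * D%:R ^+ 2).

Lemma add1_eps_ge0 : 0 <= 1 + eps.
Proof. by rewrite addr_ge0. Qed.

Lemma dset_setC : (dset d S + dset d (~: S))%N = Msum d.
Proof.
rewrite /dset /Msum [RHS](bigID (mem S)) /=; congr (_ + _)%N.
by apply: eq_bigl => i; rewrite inE.
Qed.

Lemma gamM : g * (Msum d)%:R = (dset d S)%:R.
Proof. by rewrite /gam mulfVK // pnatr_eq0 -lt0n. Qed.

Lemma gamCM : (1 - g) * (Msum d)%:R = (dset d (~: S))%:R.
Proof. by rewrite mulrBl gamM mul1r -dset_setC natrD addrAC subrr add0r. Qed.

Lemma nbrCE E v : E \in Om -> (X E v + #|nbr E v :&: ~: S|)%N = d v.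
Proof.
move=> GE; rewrite -(card_nbr v GE) -(cardsID S (nbr E v)); congr (_ + _)%N.
by apply: eq_card => x; rewrite !inE andbC.
Qed.

Lemma inner_le E v : E \in Om -> (X E v <= d v)%N.
Proof. by move=> GE; rewrite -(nbrCE v GE) leq_addr. Qed.

Definition ngraphs (P : pred {set {set 'I_n}}) : R := #|[set E in Om | P E]|%:R.

Lemma ngraphs_ge0 P : 0 <= ngraphs P. Proof. by []. Qed.

Lemma ngraphs_total Q v :
  \sum_(0 <= j < (d v).+1) ngraphs (fun E => Q E && (X E v == j)) = ngraphs Q.
Proof.
rewrite /ngraphs card_setIdE; under eq_bigr do rewrite card_setIdE.
rewrite exchange_big /=; apply: eq_bigr => E GE.
case: (Q E) => /=; last by rewrite big1.
by rewrite sum_indicator /= ltnS inner_le.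
Qed.

Lemma ler_natr_subn_maxdeg (k : nat) : k%:R - 6 * D%:R ^+ 2 <= (k - 6 * D ^ 2)%N%:R :> R.
Proof.
have [h|h] := leqP (6 * D ^ 2) k; first by rewrite natrB // natrM natrX.
rewrite (eqP (ltnW h : _ - _ == 0)%N) subr_le0.
by rewrite -natrX -natrM ler_nat ltnW.
Qed.

Section Ratios.
Variables (v : 'I_n) (U : {set 'I_n}) (Q : pred {set {set 'I_n}}).
Hypothesis U1 : (#|U| <= 1)%N.
Hypothesis vU : v \notin U.
Hypothesis QE : forall E E', {in U, nbr E =1 nbr E'} -> Q E -> Q E'.
Hypothesis Qv : forall E u, Q E -> u \in U -> u \notin nbr E v.

Let t j := ngraphs (fun E => Q E && (X E v == j)).

(** Multiplying by M turns g and 1 - g into the degree sums of the switching bound; [epsS] absorbs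
    the loss 6 D^2. *)
Lemma inner_ratio_ge : ratio_ge g eps (d v) t.
Proof.
move=> j jd; have := switch_ratio S j D0 U1 vU QE Qv.
rewrite -(ler_nat R) !natrM -/(t j) => H.
have Mp : 0 < (Msum d)%:R :> R by rewrite ltr0n.
have tj : 0 <= t j by apply: ngraphs_ge0.
have e1 := add1_eps_ge0.
rewrite -(ler_pM2l Mp).
have -> : (Msum d)%:R * (g * (d v - j)%:R * t j) = (g * (Msum d)%:R) * ((d v - j)%:R * t j).
  by ring.
have -> : (Msum d)%:R * ((1 + eps) * ((1 - g) * j.+1%:R * t j.+1))
   = (1 + eps) * (t j.+1 * (j.+1%:R * ((1 - g) * (Msum d)%:R))) by ring.
rewrite gamM gamCM; apply: le_trans (ler_wpM2l e1 H).
have -> : (1 + eps) * (t j * ((d v - j)%:R * (dset d S - 6 * D ^ 2)%:R))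
  = ((1 + eps) * (dset d S - 6 * D ^ 2)%:R) * ((d v - j)%:R * t j) by ring.
rewrite ler_wpM2r ?mulr_ge0 //; apply: (le_trans epsS).
by rewrite ler_wpM2l // ler_natr_subn_maxdeg.
Qed.

(** The same switching applied to the complement of [S]: having j + 1 neighbours in [S] means having
    d(v) - (j + 1) outside. *)
Lemma inner_ratio_le : ratio_le g eps (d v) t.
Proof.
move=> j jd; have := switch_ratio (~: S) (d v - j.+1)%N D0 U1 vU QE Qv.
have tC k : (k <= d v)%N ->
    #|[set E in Om | Q E && (#|nbr E v :&: ~: S| == (d v - k)%N)]|%:R = t k.
  move=> kd; congr _%:R; apply: eq_card => E; rewrite !inE.
  case GE : (has_degrees d E) => //=; case: (Q E) => //=.
  have /(nbrCE v) H : E \in Om by rewrite inE.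
  set x := #|_| in H *; set y := #|_| in H *.
  by apply/eqP/eqP => H1; clear -H kd H1; lia.
rewrite -(ler_nat R) !natrM tC // -[(d v - j.+1).+1]/_ subnSK // tC ?(ltnW jd) //.
rewrite subKn // setCK => H.
have Mp : 0 < (Msum d)%:R :> R by rewrite ltr0n.
have tj : 0 <= t j.+1 by apply: ngraphs_ge0.
have e1 := add1_eps_ge0.
rewrite -(ler_pM2l Mp).
have -> : (Msum d)%:R * ((1 - g) * j.+1%:R * t j.+1)
   = ((1 - g) * (Msum d)%:R) * (j.+1%:R * t j.+1) by ring.
have -> : (Msum d)%:R * ((1 + eps) * (g * (d v - j)%:R * t j))
   = (1 + eps) * (t j * ((d v - j)%:R * (g * (Msum d)%:R))) by ring.
rewrite gamM gamCM; apply: le_trans (ler_wpM2l e1 H).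
have -> : (1 + eps) * (t j.+1 * (j.+1%:R * (dset d (~: S) - 6 * D ^ 2)%:R))
  = ((1 + eps) * (dset d (~: S) - 6 * D ^ 2)%:R) * (j.+1%:R * t j.+1) by ring.
rewrite ler_wpM2r ?mulr_ge0 //; apply: (le_trans epsSC).
by rewrite ler_wpM2l // ler_natr_subn_maxdeg.
Qed.

End Ratios.

Definition inner_count v j := ngraphs (fun E => X E v == j).

Lemma inner_count_ratio v :
  ratio_ge g eps (d v) (inner_count v) /\ ratio_le g eps (d v) (inner_count v).
Proof.
have c0 : (#|(set0 : {set 'I_n})| <= 1)%N by rewrite cards0.
have v0 : v \notin set0 by rewrite inE.
split.
  apply: (inner_ratio_ge (Q := predT) c0 v0) => // E u _.
  by rewrite inE.
apply: (inner_ratio_le (Q := predT) c0 v0) => // E u _.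
by rewrite inE.
Qed.

Lemma ngraphs_predT : ngraphs predT = W.
Proof. by congr _%:R; apply: eq_card => E; rewrite !inE andbT. Qed.

Lemma inner_count_total v : \sum_(0 <= j < (d v).+1) inner_count v j = W.
Proof. by rewrite -ngraphs_predT -(ngraphs_total predT v). Qed.

Lemma inner_count_ge0 v j : 0 <= inner_count v j. Proof. by []. Qed.

Lemma inner_count_range v a b : (b <= (d v).+1)%N ->
  ngraphs (fun E => (a <= X E v < b)%N) = \sum_(a <= j < b) inner_count v j.
Proof.
move=> bd; rewrite /ngraphs card_setIdE.
under [RHS]eq_bigr do rewrite /inner_count /ngraphs card_setIdE.
by rewrite exchange_big /=; apply: eq_bigr => E _; rewrite sum_indicator.
Qed.

Lemma pmf_upper v j : (j <= d v)%N ->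
  inner_count v j <= (1 + eps) ^+ d v * (bpmf g (d v) j * W).
Proof.
move=> jd; have [Hge Hle] := inner_count_ratio v.
by have := bpmf_upper gam0 gam1 eps0 (inner_count_ge0 v) Hle Hge jd; rewrite inner_count_total.
Qed.

Lemma pmf_lower v j : (j <= d v)%N ->
  bpmf g (d v) j * W <= (1 + eps) ^+ d v * inner_count v j.
Proof.
move=> jd; have [Hge Hle] := inner_count_ratio v.
by have := bpmf_lower gam0 gam1 eps0 (inner_count_ge0 v) Hle Hge jd; rewrite inner_count_total.
Qed.

Lemma pmf_oversize v j : (d v < j)%N -> inner_count v j = 0.
Proof.
move=> dj; rewrite /inner_count /ngraphs (eq_card0 (A := [set E in Om | _])) // => E.
rewrite inE; apply/negbTE/negP => /andP[GE /eqP H].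
by have := inner_le v GE; rewrite H leqNgt dj.
Qed.

Definition apart u v : pred {set {set 'I_n}} := fun E => u \notin nbr E v.

(** Two rounds of freezing: with the neighbourhood of [u] fixed, X_v is nearly binomial; then,
    freezing that of [v] and remembering only non-adjacency, X_u is. The errors multiply. *)
Lemma joint_apart u v a b : u != v -> (a <= d u)%N -> (b <= d v)%N ->
  ngraphs (fun E => (apart u v E && (X E u == a)) && (X E v == b))
    <= (1 + eps) ^+ (d u + d v) * (bpmf g (d u) a * bpmf g (d v) b * W).
Proof.
move=> uv au bv.
have c1 (w : 'I_n) : (#|[set w]| <= 1)%N by rewrite cards1.
have e1 := add1_eps_ge0.
have vu1 : v \notin [set u] by rewrite inE eq_sym.
have uv1 : u \notin [set v] by rewrite inE.
pose Qu E := apart u v E && (X E u == a).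
have QuE E E' : {in [set u], nbr E =1 nbr E'} -> Qu E -> Qu E'.
  move=> /(_ u (set11 u)) H; rewrite /Qu /apart.
  by rewrite nbr_sym [u \in nbr E' v]nbr_sym H.
have Quv E w : Qu E -> w \in [set u] -> w \notin nbr E v.
  by move=> /andP[H _] /set1P->.
have H1 := bpmf_upper gam0 gam1 eps0 (fun j => ngraphs_ge0 _)
  (inner_ratio_le (c1 u) vu1 QuE Quv) (inner_ratio_ge (c1 u) vu1 QuE Quv) bv.
apply: (le_trans H1); rewrite ngraphs_total.
pose Qv := apart u v.
have QvE E E' : {in [set v], nbr E =1 nbr E'} -> Qv E -> Qv E'.
  by move=> /(_ v (set11 v)) H; rewrite /Qv /apart H.
have Qvu E w : Qv E -> w \in [set v] -> w \notin nbr E u.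
  by move=> H /set1P->; rewrite nbr_sym.
have H2 := bpmf_upper gam0 gam1 eps0 (fun j => ngraphs_ge0 _)
  (inner_ratio_le (c1 v) uv1 QvE Qvu) (inner_ratio_ge (c1 v) uv1 QvE Qvu) au.
rewrite ngraphs_total in H2.
have bp : 0 <= bpmf g (d v) b by rewrite bpmf_ge0 ?ltW.
have bpu : 0 <= bpmf g (d u) a by rewrite bpmf_ge0 ?ltW.
have QW : ngraphs Qv <= W by rewrite -ngraphs_predT; apply: card_setId_le.
have H3 : ngraphs Qu <= (1 + eps) ^+ d u * (bpmf g (d u) a * W).
  by apply: (le_trans H2); rewrite ler_wpM2l ?exprn_ge0 // ler_wpM2l.
have -> : (1 + eps) ^+ (d u + d v) * (bpmf g (d u) a * bpmf g (d v) b * W) =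
    (1 + eps) ^+ d v * (bpmf g (d v) b * ((1 + eps) ^+ d u * (bpmf g (d u) a * W))).
  by rewrite exprD; set x := _ ^+ d u; set y := _ ^+ d v; ring.
by rewrite ler_wpM2l ?exprn_ge0 // ler_wpM2l.
Qed.

(** Removing the edge uv may lower an inner degree by one, so the weight at a - 1 must be paid for
    by that at a. By the recursion their ratio is at most a/g. *)
Lemma bpmf_pred (B : R) m a a' : (a <= m)%N -> 1 <= B -> a%:R <= B * g ->
  (a.-1 <= a' <= a)%N -> bpmf g m a' <= B * bpmf g m a.
Proof.
move=> am B1 aB aa'.
have p0 k : 0 <= bpmf g m k by rewrite bpmf_ge0 ?ltW.
have [->|na] := eqVneq a' a; first by rewrite ler_peMl.
case: a am aB aa' na => [|a] am aB aa' na; first by lia.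
have -> : a' = a by lia.
have := bpmf_ratio g am => H.
rewrite -(ler_pM2l gam0).
have h1 : g * bpmf g m a <= g * (m - a)%:R * bpmf g m a.
  rewrite ler_wpM2r // ler_peMr ?(ltW gam0) //.
  by rewrite ler1n subn_gt0.
apply: (le_trans h1); rewrite -H [leRHS]mulrA; apply: ler_wpM2r; first exact: p0.
rewrite [g * B]mulrC; apply: le_trans aB.
by rewrite -[leRHS]mul1r ler_wpM2r // lerBlDr lerDl ltW.
Qed.

(** The switched graphs have inner degrees in {i - 1, i}: at most four pairs, each costing a factor
    B^2 relative to (i, i). *)
Lemma joint_adjacent (B : R) u v i : u \in S -> v \in S -> u != v ->
  (i <= d u)%N -> (i <= d v)%N -> 1 <= B -> i%:R <= B * g ->
  ngraphs (fun E => (u \in nbr E v) && ((X E u == i) && (X E v == i)))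
      * ((Msum d)%:R - 6 * D%:R ^+ 2)
    <= 4 * B ^+ 2 * ((d u)%:R * (d v)%:R)
      * ((1 + eps) ^+ (d u + d v) * (bpmf g (d u) i * bpmf g (d v) i * W)).
Proof.
move=> uS vS uv iu iv B1 iB.
have := switch_adjacent i i uS vS D0; rewrite -(ler_nat R) !natrM => H.
apply: le_trans (_ : _ <= ngraphs (fun E => (u \in nbr E v) && ((X E u == i) && (X E v == i)))
      * (Msum d - 6 * D ^ 2)%N%:R) _.
  by rewrite ler_wpM2l ?ngraphs_ge0 // ler_natr_subn_maxdeg.
apply: (le_trans H); rewrite [leRHS]mulrAC ler_wpM2r ?mulr_ge0 //.
set K := (1 + eps) ^+ _ * _.
have K0 : 0 <= K.
  apply: mulr_ge0; first exact: exprn_ge0 add1_eps_ge0.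
  by apply: mulr_ge0 => //; apply: mulr_ge0; rewrite bpmf_ge0 ?ltW.
have pu k : 0 <= bpmf g (d u) k by rewrite bpmf_ge0 ?ltW.
have pv k : 0 <= bpmf g (d v) k by rewrite bpmf_ge0 ?ltW.
pose r a b := ngraphs (fun E => (apart u v E && (X E u == a)) && (X E v == b)).
have rK a b : (i.-1 <= a < i.+1)%N -> (i.-1 <= b < i.+1)%N -> r a b <= B ^+ 2 * K.
  move=> Ha Hb; have au : (a <= d u)%N by apply: leq_trans iu; case/andP: Ha.
  have bv : (b <= d v)%N by apply: leq_trans iv; case/andP: Hb.
  apply: (le_trans (joint_apart uv au bv)).
  rewrite /K [leRHS]mulrCA ler_wpM2l ?exprn_ge0 ?add1_eps_ge0 //.
  rewrite [leRHS]mulrA ler_wpM2r //.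
  have -> : B ^+ 2 * (bpmf g (d u) i * bpmf g (d v) i)
    = (B * bpmf g (d u) i) * (B * bpmf g (d v) i) by ring.
  by apply: ler_pM => //; apply: bpmf_pred.
have -> : 4 * B ^+ 2 * K = 2 * (2 * (B ^+ 2 * K)) by ring.
have BK : 0 <= B ^+ 2 * K by rewrite mulr_ge0 ?sqr_ge0.
have two (F : nat -> R) (c : R) : 0 <= c ->
    (forall a, (i.-1 <= a < i.+1)%N -> F a <= c) ->
    \sum_(i.-1 <= a < i.+1) F a <= 2 * c.
  move=> c0 HF; apply: (@le_trans _ _ (\sum_(i.-1 <= a < i.+1) c)).
    by apply: ler_sum_nat => a Ha; apply: HF.
  rewrite sumr_const_nat -[leLHS]mulr_natl ler_wpM2r // ler_nat; clear; lia.
apply: (@le_trans _ _ (\sum_(i.-1 <= a < i.+1) \sum_(i.-1 <= b < i.+1) r a b)).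
  rewrite card_setIdE.
  under [leRHS]eq_bigr do under eq_bigr do rewrite /r /ngraphs card_setIdE.
  under [leRHS]eq_bigr do rewrite exchange_big /=.
  rewrite exchange_big /=; apply: ler_sum => E GE.
  case: (boolP (u \in nbr E v)) => uvE /=.
    by apply: sumr_ge0 => a _; apply: sumr_ge0 => b _.
  under eq_bigr => a _.
    under eq_bigr => b _ do rewrite /apart uvE /= -mulnb natrM.
    rewrite -mulr_sumr sum_indicator; over.
  by rewrite -mulr_suml sum_indicator -natrM mulnb !ltnS.
apply: (two); first by rewrite mulr_ge0.
by move=> a Ha; apply: two => // b Hb; apply: rK.
Qed.

Lemma joint_upper (B : R) u v i : u \in S -> v \in S -> u != v ->
  (i <= d u)%N -> (i <= d v)%N -> 1 <= B -> i%:R <= B * g ->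
  0 < (Msum d)%:R - 6 * D%:R ^+ 2 :> R ->
  ngraphs (fun E => (X E u == i) && (X E v == i))
    <= (1 + 4 * B ^+ 2 * ((d u)%:R * (d v)%:R) / ((Msum d)%:R - 6 * D%:R ^+ 2))
      * ((1 + eps) ^+ (d u + d v) * (bpmf g (d u) i * bpmf g (d v) i * W)).
Proof.
move=> uS vS uv iu iv B1 iB MD.
rewrite mulrDl mul1r.
apply: le_trans (_ : _ <= ngraphs (fun E => (apart u v E && (X E u == i)) && (X E v == i)) +
   ngraphs (fun E => (u \in nbr E v) && ((X E u == i) && (X E v == i)))) _.
  apply: le_trans (card_setIdU_le _ _ _ _); apply: card_setId_le => E _.
  by rewrite /apart => /andP[-> ->]; case: (_ \in _).
apply: lerD; first exact: joint_apart.
rewrite mulrAC ler_pdivlMr //.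
by apply: (le_trans (joint_adjacent uS vS uv iu iv B1 iB)).
Qed.

End InnerDegrees.

(** * The estimates for one fixed n, with e = delta^(1/64) and L = log M *)

Section Finite.
Import mathcomp.boot.finset.
Local Open Scope ring_scope.
Variables (R : realType) (n : nat) (d : 'I_n -> nat) (S : {set 'I_n}).
Variables e L C c : R.
Notation g := (gam d S : R).
Notation Om := (graphs_deg d).
Notation D := (maxdeg d).
Notation M := ((Msum d)%:R : R).
Notation W := (#|Om|%:R : R).
Notation X E v := #|nbr E v :&: S|.
Notation eps := (C ^- 10).
Notation ngraphs := (@ngraphs R n d).

Hypothesis d_mono : forall i j : 'I_n, (i <= j)%N -> (d i <= d j)%N.
Hypothesis d_pos : forall i, (0 < d i)%N.
Hypothesis S_pos : (0 < #|S|)%N.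
Hypothesis e0 : 0 < e.
Hypothesis e_small : 100 * e <= 1.
Hypothesis LE : L = ln M.
Hypothesis L_big : 20 <= L.
Hypothesis c0 : 0 < c.
Hypothesis Lc : 12 <= c * L.
Hypothesis gc : g < 1 - c.
Hypothesis CE : C * (e ^+ 4 * g) = L.
Hypothesis key : D%:R ^+ 2 * C ^+ 12 <= e ^+ 16 * (g * M).

Lemma dS_pos : (0 < dset d S)%N.
Proof.
have /card_gt0P[v vS] := S_pos.
by rewrite /dset (bigD1 v) //= ltn_addr.
Qed.

Lemma M_pos : (0 < Msum d)%N.
Proof. by rewrite -(dset_setC d S) ltn_addr // dS_pos. Qed.

Lemma D_pos : (0 < D)%N.
Proof.
have /card_gt0P[v vS] := S_pos.
exact: leq_trans (d_pos v) (deg_le_maxdeg d v).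
Qed.

Lemma g_pos : 0 < g.
Proof. by rewrite divr_gt0 // ltr0n ?dS_pos ?M_pos. Qed.

Lemma g_lt1 : g < 1.
Proof. by apply: (lt_trans gc); rewrite ltrBlDr ltrDl. Qed.

Lemma MrE : M = expR L.
Proof. by rewrite LE lnK // posrE ltr0n M_pos. Qed.

Lemma L_pos : 0 < L.
Proof. by apply: lt_le_trans L_big; rewrite ltr0n. Qed.

Lemma e_lt1 : e < 1.
Proof. by have := e0; have := e_small; lra. Qed.

Lemma eX_le1 k : e ^+ k <= 1.
Proof. by rewrite exprn_ile1 // ltW // e_lt1. Qed.

Lemma e4g_pos : 0 < e ^+ 4 * g.
Proof. by rewrite mulr_gt0 ?exprn_gt0 ?g_pos. Qed.

Lemma C_pos : 0 < C.
Proof. by rewrite -(pmulr_lgt0 _ e4g_pos) CE L_pos. Qed.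

Lemma L_le_Ce : L <= C * e ^+ 4.
Proof.
rewrite -CE mulrA ler_piMr ?(ltW g_lt1) // mulr_ge0 ?(ltW C_pos) //.
by rewrite exprn_ge0 // ltW.
Qed.

Lemma L_le_gC : L <= g * C.
Proof.
rewrite -CE mulrCA [g * C]mulrC ler_piMl ?eX_le1 //.
by rewrite mulr_ge0 ?(ltW C_pos) ?(ltW g_pos).
Qed.

Lemma gC_le_C : g * C <= C.
Proof. by rewrite ler_piMl ?(ltW C_pos) ?(ltW g_lt1). Qed.

Lemma L_le_C : L <= C.
Proof. exact: le_trans L_le_gC gC_le_C. Qed.

Lemma C_big : 20 <= C.
Proof. exact: le_trans L_big L_le_C. Qed.

Lemma eps_pos : 0 < eps.
Proof. by rewrite invr_gt0 exprn_gt0 // C_pos. Qed.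

Lemma CX_ge k : 1 <= C ^+ k.
Proof. by rewrite exprn_ege1 //; apply: le_trans C_big; rewrite ler1n. Qed.

Lemma eps_le1 : eps <= 1.
Proof. by rewrite invf_le1 ?CX_ge // exprn_gt0 // C_pos. Qed.

Lemma eps_le_e : 2 * eps <= e.
Proof.
have C0 := C_pos.
have h : 2 <= C * e.
  apply: (@le_trans _ _ (C * e ^+ 4)).
    by apply: le_trans L_le_Ce; apply: le_trans L_big; rewrite ler_nat.
  by rewrite ler_pM2l // exprS ler_piMr ?eX_le1 // ltW.
rewrite ler_pdivrMr ?exprn_gt0 //; apply: (le_trans h).
by rewrite [C ^+ 10]exprS mulrA [e * C]mulrC ler_peMr ?CX_ge // mulr_ge0 // ltW.
Qed.

(** 12 is twice the loss 6 D^2, which leaves room for the product eps * 6 D^2 in [epsS]. It is paid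
    for by C^2, the gap between C^12 and C^10. *)
Lemma DS_bound : 12 * D%:R ^+ 2 <= eps * (g * M).
Proof.
have C0 := C_pos; have C2 : 0 < C ^+ 2 by rewrite exprn_gt0.
have gM0 : 0 <= g * M by rewrite mulr_ge0 // ltW // g_pos.
rewrite [leRHS]mulrC ler_pdivlMr ?exprn_gt0 // -(ler_pM2l C2).
apply: (@le_trans _ _ (12 * (D%:R ^+ 2 * C ^+ 12))).
  by rewrite le_eqVlt; apply/orP; left; apply/eqP; ring.
apply: (@le_trans _ _ (12 * (g * M))).
  by rewrite ler_pM2l //; apply: (le_trans key); rewrite ler_piMl ?eX_le1.
rewrite ler_wpM2r //; apply: (@le_trans _ _ C).
  by apply: le_trans C_big; rewrite ler_nat.
by rewrite expr2 ler_peMl ?(ltW C0) //; exact: (CX_ge 1).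
Qed.

(** For the complement the constant 12 is met by 12 <= c L <= (1 - g) C^2; this is where the gap
    between gamma and 1 enters quantitatively. *)
Lemma DSC_bound : 12 * D%:R ^+ 2 <= eps * ((1 - g) * M).
Proof.
have C0 := C_pos; have C2 : 0 < C ^+ 2 by rewrite exprn_gt0.
have gM0 : 0 <= g * M by rewrite mulr_ge0 // ltW // g_pos.
rewrite [leRHS]mulrC ler_pdivlMr ?exprn_gt0 // -(ler_pM2l C2).
apply: (@le_trans _ _ (12 * (D%:R ^+ 2 * C ^+ 12))).
  by rewrite le_eqVlt; apply/orP; left; apply/eqP; ring.
apply: (@le_trans _ _ (12 * M)).
  rewrite ler_pM2l //; apply: (le_trans key).
  apply: (@le_trans _ _ (g * M)); first by rewrite ler_piMl ?eX_le1.
  by rewrite ler_piMl // ltW // g_lt1.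
rewrite mulrA ler_wpM2r //; apply: (le_trans Lc).
rewrite mulrC; apply: ler_pM; rewrite ?(ltW c0) ?(ltW L_pos) //.
  apply: (le_trans L_le_C).
  by rewrite expr2 ler_peMl ?(ltW C0) //; exact: (CX_ge 1).
by rewrite lerBrDr -lerBrDl ltW.
Qed.

Lemma epsS : (dset d S)%:R <= (1 + eps) * ((dset d S)%:R - 6 * D%:R ^+ 2).
Proof.
have := DS_bound; rewrite gamM ?M_pos // => H.
have : eps * D%:R ^+ 2 <= D%:R ^+ 2 by rewrite ler_piMl ?eps_le1 // sqr_ge0.
by lra.
Qed.

Lemma epsSC : (dset d (~: S))%:R <= (1 + eps) * ((dset d (~: S))%:R - 6 * D%:R ^+ 2).
Proof.
have := DSC_bound; rewrite gamCM ?M_pos // => H.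
have : eps * D%:R ^+ 2 <= D%:R ^+ 2 by rewrite ler_piMl ?eps_le1 // sqr_ge0.
by lra.
Qed.

Lemma C12_le_M : C ^+ 12 <= M.
Proof.
apply: (@le_trans _ _ (D%:R ^+ 2 * C ^+ 12)).
  rewrite ler_peMl //; first by rewrite exprn_ge0 // ltW // C_pos.
  by rewrite exprn_ege1 // ler1n D_pos.
have gM0 : 0 <= g * M by rewrite mulr_ge0 // ltW // g_pos.
apply: (le_trans key); apply: (@le_trans _ _ (g * M)); first by rewrite ler_piMl ?eX_le1.
by rewrite ler_piMl // ltW // g_lt1.
Qed.

Lemma MD_half : M / 2 <= M - 6 * D%:R ^+ 2.
Proof.
have gM : g * M <= M by rewrite ler_piMl // ltW // g_lt1.
have gM0 : 0 <= g * M by rewrite mulr_ge0 // ltW // g_pos.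
have := DS_bound; have : eps * (g * M) <= g * M by rewrite ler_piMl // eps_le1.
by lra.
Qed.

(** This is M^-3, small enough for a union bound over the at most M vertices of [S]. *)
Definition theta : R := expR (- (3 * L)).

Lemma theta_ge0 : 0 <= theta. Proof. exact: expR_ge0. Qed.

Lemma cardS_le_M : (#|S|%:R <= M :> R).
Proof.
rewrite ler_nat; apply: (leq_trans (max_card _)); rewrite card_ord.
by rewrite -[leqLHS]card_ord -sum1_card; apply: leq_sum => i _.
Qed.

Lemma card_theta : #|S|%:R * theta <= (2 * L)^-1.
Proof.
apply: (@le_trans _ _ (M * theta)); first by rewrite ler_wpM2r ?theta_ge0 ?cardS_le_M.
rewrite MrE /theta -expRD [L + _](_ : _ = - (2 * L)); last by ring.
rewrite expRN lef_pV2 ?posrE ?expR_gt0 //; last by rewrite mulr_gt0 // L_pos.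
by apply: le_trans (expR_ge1Dx _); rewrite lerDr.
Qed.

Lemma card_theta_half : #|S|%:R * theta < 2^-1.
Proof.
apply: (le_lt_trans card_theta); rewrite ltf_pV2 ?posrE //; last first.
  by rewrite mulr_gt0 // L_pos.
by rewrite ltr_pMr //; apply: lt_le_trans L_big; rewrite ltr1n.
Qed.

(** The value of gamma d at the threshold d = delta^(1/32) C that separates (a) from (b). It is
    chosen so that e^2 m = L, the size a tail exponent must have. *)
Let m : R := g * C * e ^+ 2.

Lemma mE : m * e ^+ 2 = L.
Proof. by rewrite /m -CE; ring. Qed.

Let eta : R := 11 / 4 * e.

(* The tail bound of [upper_tail] and [lower_tail] is then at most [M^-3]; it is
   used with [eta] = 11e/4 (so 2 eta = 5.5e leaves room for the constants 8 and
   12) and with eta = 1/2. *)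
Definition tail_ok (h mu : R) : Prop :=
  [/\ 0 < h, h <= 2^-1, eps <= h / 4, 0 <= mu & 3 * L <= h / 2 * (h * mu - 1)].

Lemma tail_ok_eta mu : m <= mu -> tail_ok eta mu.
Proof.
move=> mmu; have L0 := L_pos; have ee := eps_le_e; have e0' := e0; have es := e_small.
have LL := L_big.
have m0 : 0 <= m.
  by rewrite /m !mulr_ge0 ?exprn_ge0 // ?(ltW g_pos) ?(ltW C_pos) ?(ltW e0).
have eta0 : 0 < eta by rewrite /eta; lra.
have eta1 : eta <= 2^-1 by rewrite /eta; lra.
have eta2 : eps <= eta / 4 by rewrite /eta; lra.
split=> //; first exact: le_trans mmu.
have e2 : 0 <= e ^+ 2 by rewrite sqr_ge0.
have := ler_wpM2l e2 mmu; rewrite mulrC mE => H.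
have -> : eta / 2 * (eta * mu - 1)
   = 121 / 32 * (e ^+ 2 * mu) - 11 / 8 * e by rewrite /eta; field.
by lra.
Qed.

(** With deviation parameter 1/2 the bound (1 + 2 h) m is 2 m, exactly the right-hand side of
    (b). *)
Lemma tail_ok_half : tail_ok 2^-1 m.
Proof.
have L0 := L_pos; have ee := eps_le_e; have es := e_small; have LL := L_big.
have m0 : 0 <= m.
  by rewrite /m !mulr_ge0 ?exprn_ge0 // ?(ltW g_pos) ?(ltW C_pos) ?(ltW e0).
have e2 : 100 * e ^+ 2 <= 1.
  apply: le_trans e_small; rewrite ler_pM2l // expr2 ler_piMr // ltW // e_lt1 //.
have := ler_wpM2l m0 e2; rewrite mulrCA mE mulr1 => H.
have q8 : 2^-1 / 4 = 8^-1 :> R by field.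
have q4 : 2^-1 / 2 = 4^-1 :> R by field.
by rewrite /tail_ok q8 q4; split; lra.
Qed.

Lemma tail_exp h mu : tail_ok h mu -> expR (- (h / 2 * (h * mu - 1))) <= theta.
Proof. by case=> _ _ _ _ H; rewrite ler_expR lerN2. Qed.

Lemma trunc_lt (x : R) (k : nat) : 0 <= x -> x < k%:R -> (Num.trunc x < k)%N.
Proof.
move=> x0 xk; rewrite -(ltr_nat R); apply: le_lt_trans xk.
by have /andP[] := Num.Theory.truncn_itv x0.
Qed.

Lemma upper_event h mu v : tail_ok h mu -> g * (d v)%:R <= mu ->
  ngraphs (fun E => (1 + 2 * h) * mu < (X E v)%:R) <= theta * W.
Proof.
move=> ok gd; have [h0 h1 h2 mu0 h3] := ok.
have x0 : 0 <= (1 + 2 * h) * mu by rewrite mulr_ge0 // addr_ge0 // mulr_ge0 // ltW.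
set k := (Num.trunc ((1 + 2 * h) * mu)).+1.
apply: (@le_trans _ _ (ngraphs (fun E => (k <= X E v < (d v).+1)%N))).
  apply: card_setId_le => E GE H; rewrite ltnS inner_le // andbT.
  exact: trunc_lt.
rewrite inner_count_range //.
have [Hge Hle] := inner_count_ratio D_pos M_pos (ltW eps_pos) epsS epsSC v.
have ku : (1 + 2 * h) * mu <= k%:R.
  by have /andP[_ /ltW] := Num.Theory.truncn_itv x0.
apply: (le_trans (upper_tail g_pos g_lt1 gd h0 h1 (ltW eps_pos) h2
  (inner_count_ge0 R d S v) Hle ku)).
by rewrite inner_count_total ler_wpM2r // tail_exp.
Qed.

Lemma lower_event h mu v : tail_ok h mu -> mu <= g * (d v)%:R ->
  ngraphs (fun E => (X E v)%:R < (1 - 2 * h) * mu) <= theta * W.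
Proof.
move=> ok gd; have [h0 h1 h2 mu0 h3] := ok.
have x0 : 0 <= (1 - 2 * h) * mu by rewrite mulr_ge0 // subr_ge0; lra.
set k := Num.trunc ((1 - 2 * h) * mu).
have /andP[kl ku] := Num.Theory.truncn_itv x0.
have kmu : k%:R <= mu by apply: (le_trans kl); rewrite ler_piMl //; lra.
have gd' : g * (d v)%:R <= (d v)%:R by rewrite ler_piMl // ltW // g_lt1.
have kd : (k <= d v)%N.
  by rewrite -(ler_nat R); apply: (le_trans kmu); apply: (le_trans gd).
apply: (@le_trans _ _ (ngraphs (fun E => (0 <= X E v < k.+1)%N))).
  apply: card_setId_le => E GE H; rewrite leq0n /=.
  by rewrite -(ltr_nat R); apply: (lt_trans H).
rewrite inner_count_range //.
have [Hge Hle] := inner_count_ratio D_pos M_pos (ltW eps_pos) epsS epsSC v.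
apply: (le_trans (lower_tail g_pos g_lt1 mu0 gd h0 h1 (ltW eps_pos) h2
  (inner_count_ge0 R d S v) Hge kl)).
by rewrite inner_count_total ler_wpM2r // tail_exp.
Qed.

Lemma upper_binom h mu j k : tail_ok h mu -> g * j%:R <= mu ->
  (1 + 2 * h) * mu <= k.+1%:R -> 1 - theta <= binom_cdf g j k.
Proof.
move=> ok gd kk; have [h0 h1 h2 mu0 h3] := ok.
have p0 i : 0 <= bpmf g j i by rewrite bpmf_ge0 ?ltW ?g_pos ?g_lt1.
have Hle := bpmf_ratio_le (d := j) (ltW eps_pos) (ltW g_pos) (ltW g_lt1).
have := upper_tail g_pos g_lt1 gd h0 h1 (ltW eps_pos) h2 p0 Hle kk.
rewrite sum_bpmf mulr1 => H; rewrite binom_cdfE sum_bpmf_tail.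
by rewrite lerD2l lerN2; apply: (le_trans H); apply: tail_exp.
Qed.

Lemma lower_binom h mu j k : tail_ok h mu -> mu <= g * j%:R ->
  k%:R <= (1 - 2 * h) * mu -> binom_cdf g j k <= theta.
Proof.
move=> ok gd kk; have [h0 h1 h2 mu0 h3] := ok.
have p0 i : 0 <= bpmf g j i by rewrite bpmf_ge0 ?ltW ?g_pos ?g_lt1.
have Hge := bpmf_ratio_ge (d := j) (ltW eps_pos) (ltW g_pos) (ltW g_lt1).
have := lower_tail g_pos g_lt1 mu0 gd h0 h1 (ltW eps_pos) h2 p0 Hge kk.
rewrite sum_bpmf mulr1 => H; rewrite binom_cdfE.
by apply: (le_trans H); apply: tail_exp.
Qed.

Notation dH := (dHseq (R:=R) d S).

Lemma d_iS (j k : 'I_#|S|) : (j <= k)%N -> (d (iS j) <= d (iS k))%N.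
Proof. by move=> jk; apply: d_mono; apply: iS_leq. Qed.

(** Degrees increase along [S], so a bound on the mean at index [k] covers all earlier indices, as
    [dHseq_le] requires. *)
Lemma dH_upper h mu (k : 'I_#|S|) : tail_ok h mu -> g * (d (iS k))%:R <= mu ->
  (nth 0%N dH k)%:R <= (1 + 2 * h) * mu.
Proof.
move=> ok gd; have [h0 h1 h2 mu0 h3] := ok.
have x0 : 0 <= (1 + 2 * h) * mu by rewrite mulr_ge0 // addr_ge0 // mulr_ge0 // ltW.
have /andP[kl ku] := Num.Theory.truncn_itv x0.
apply: le_trans kl; rewrite ler_nat.
apply: (dHseq_le g_pos g_lt1 theta_ge0 card_theta_half) => j jk.
apply: (upper_binom ok); last exact: ltW.
by apply: le_trans gd; rewrite ler_pM2l ?g_pos // ler_nat d_iS.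
Qed.

Lemma dH_lower h mu (k : 'I_#|S|) : tail_ok h mu -> mu <= g * (d (iS k))%:R ->
  (1 - 2 * h) * mu <= (nth 0%N dH k)%:R.
Proof.
move=> ok gd; have [h0 h1 h2 mu0 h3] := ok.
have x0 : 0 <= (1 - 2 * h) * mu by rewrite mulr_ge0 // subr_ge0; lra.
have /andP[kl ku] := Num.Theory.truncn_itv x0.
apply: ltW; apply: (lt_le_trans ku); rewrite ler_nat.
apply: (dHseq_gt g_pos g_lt1 theta_ge0 card_theta_half) => j kj.
apply: (lower_binom ok) kl.
by apply: (le_trans gd); rewrite ler_pM2l ?g_pos // ler_nat d_iS.
Qed.

Definition bad_vertex v E : bool :=
  if m <= g * (d v)%:R then
    ((1 + 2 * eta) * (g * (d v)%:R) < (X E v)%:R)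
    || ((X E v)%:R < (1 - 2 * eta) * (g * (d v)%:R))
  else (1 + 2 * 2^-1) * m < (X E v)%:R.

Lemma bad_vertex_count v : ngraphs (bad_vertex v) <= 2 * theta * W.
Proof.
have tW : 0 <= theta * W by rewrite mulr_ge0 ?theta_ge0.
have [H|H] := leP m (g * (d v)%:R).
  rewrite -mulrA mulr_natl mulr2n.
  apply: le_trans (lerD (upper_event (tail_ok_eta H) (lexx _))
                        (lower_event (tail_ok_eta H) (lexx _))).
  apply: le_trans (card_setIdU_le _ _ _ _); apply: card_setId_le => E _.
  by rewrite /bad_vertex H.
apply: (@le_trans _ _ (theta * W)); last by rewrite -mulrA mulr_natl mulr2n lerDl.
apply: le_trans (upper_event tail_ok_half (ltW H)); apply: card_setId_le => E _.
by rewrite /bad_vertex leNgt H.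
Qed.

(** 44 = 8 + 4 + 32 comes from expanding (1 + 8 C^-8)(1 + 4 C^-9) and bounding every error term by a
    multiple of C^-8. *)
Definition kappa : R := 44 * C ^- 8.

Lemma CVX_pos k : 0 < C ^- k.
Proof. by rewrite invr_gt0 exprn_gt0 // C_pos. Qed.

Lemma CVXS k : 20 * C ^- k.+1 <= C ^- k.
Proof.
rewrite exprS invfM mulrA ler_piMl ?(ltW (CVX_pos _)) //.
by rewrite ler_pdivrMr ?C_pos // mul1r C_big.
Qed.

Lemma CVX_le1 k : C ^- k <= 1.
Proof. by rewrite invf_le1 ?CX_ge // exprn_gt0 // C_pos. Qed.

Lemma kappa_ge0 : 0 <= kappa.
Proof. by rewrite mulr_ge0 // ltW // CVX_pos. Qed.

Lemma kappa_le1 : kappa <= 1.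
Proof.
rewrite /kappa; have h7 := CVXS 7; have h6 := CVXS 6; have := CVX_le1 6.
have := CVX_pos 8; lra.
Qed.

Lemma pow_eps k : k%:R <= 2 * C -> (1 + eps) ^+ k <= 1 + 4 * C ^- 9.
Proof.
move=> kC; set x := k%:R * eps.
have C0 := C_pos; have e10 := eps_pos.
have x0 : 0 <= x by rewrite mulr_ge0 // ltW.
have x9 : x <= 2 * C ^- 9.
  apply: (@le_trans _ _ (2 * C * eps)); first by rewrite ler_pM2r.
  by rewrite le_eqVlt; apply/orP; left; apply/eqP; field; rewrite gt_eqF.
have x2 : x <= 2^-1.
  by have := CVXS 8; have := CVX_le1 8; lra.
have ex : (1 + eps) ^+ k <= expR x.
  rewrite /x expRM_natl lerXn2r ?nnegrE ?expR_ge0 ?expR_ge1Dx //.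
  by rewrite addr_ge0 // ltW.
have h1 : expR x * (1 - x) <= 1.
  rewrite -[leRHS](expRxMexpNx_1 x) ler_wpM2l ?expR_ge0 //.
  by rewrite -[- x]/(- x); exact: expR_ge1Dx.
have h2 : 1 <= (1 - x) * (1 + 2 * x).
  have : x * x <= x * 2^-1 by rewrite ler_wpM2l.
  by lra.
apply: (le_trans ex); apply: (@le_trans _ _ (1 + 2 * x)); last by lra.
have := ler_wpM2l (expR_ge0 x) h2; have h3 : 0 <= 1 + 2 * x by lra.
have := ler_wpM2r h3 h1; lra.
Qed.

(** Only here do the accumulated step errors stay near 1. The remaining vertices of [S] have mean at
    least gamma C, so concentration keeps them away from the values i <= gamma C / 2. *)
Definition low : {set 'I_n} := [set v in S | (d v)%:R < C].

Definition mean i : R := \sum_(v in low) bpmf g (d v) i.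

Lemma bpmfd_ge0 v i : 0 <= bpmf g (d v) i.
Proof. by rewrite bpmf_ge0 ?ltW ?g_pos ?g_lt1. Qed.

Lemma mean_ge0 i : 0 <= mean i.
Proof. by apply: sumr_ge0 => v _; apply: bpmfd_ge0. Qed.

Lemma low_upper v i : v \in low -> inner_count R d S v i <= (1 + kappa) * bpmf g (d v) i * W.
Proof.
rewrite inE => /andP[vS vC]; have [iv|vi] := leqP i (d v); last first.
  by rewrite pmf_oversize // bpmf_oversize // mulr0 mul0r.
apply: (le_trans (pmf_upper D_pos g_pos g_lt1 M_pos (ltW eps_pos) epsS epsSC iv)).
have Hk : (1 + eps) ^+ d v <= 1 + kappa.
  apply: (le_trans (pow_eps _)); first by have := C_pos; lra.
  by rewrite /kappa; have := CVXS 8; have := CVX_pos 9; lra.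
rewrite -[leRHS]mulrA; apply: ler_wpM2r Hk.
by apply: mulr_ge0 => //; apply: bpmfd_ge0.
Qed.

Lemma low_lower v i : v \in low -> (1 - kappa) * bpmf g (d v) i * W <= inner_count R d S v i.
Proof.
rewrite inE => /andP[vS vC]; have [iv|vi] := leqP i (d v); last first.
  by rewrite pmf_oversize // bpmf_oversize // mulr0 mul0r.
have H := pmf_lower D_pos g_pos g_lt1 M_pos (ltW eps_pos) epsS epsSC iv.
have t0 : 0 <= inner_count R d S v i by apply: inner_count_ge0.
have Hk : (1 + eps) ^+ d v <= 1 + kappa.
  apply: (le_trans (pow_eps _)); first by have := C_pos; lra.
  by rewrite /kappa; have := CVXS 8; have := CVX_pos 9; lra.
have k1 := kappa_le1; have k0 := kappa_ge0.
have k1' : 0 <= 1 - kappa by lra.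
rewrite -mulrA; apply: (le_trans (ler_wpM2l k1' H)).
rewrite mulrA -[leRHS]mul1r ler_wpM2r //.
apply: (le_trans (ler_wpM2l k1' Hk)).
by have := mulr_ge0 k0 k0; lra.
Qed.

Lemma low_joint u v i : u \in low -> v \in low -> u != v -> i%:R <= 2^-1 * g * C ->
  ngraphs (fun E => (X E u == i) && (X E v == i))
    <= (1 + kappa) * (bpmf g (d u) i * bpmf g (d v) i) * W.
Proof.
rewrite !inE => /andP[uS uC] /andP[vS vC] uv iC.
have C0 := C_pos; have g0 := g_pos.
have R0 : 0 <= (1 + kappa) * (bpmf g (d u) i * bpmf g (d v) i) * W.
  have k0 := kappa_ge0; apply: mulr_ge0 => //; apply: mulr_ge0; first by lra.
  by apply: mulr_ge0; apply: bpmfd_ge0.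
have [iu|ui] := leqP i (d u); last first.
  apply: le_trans R0; rewrite -[leRHS](pmf_oversize R S ui).
  by apply: card_setId_le => E _ /andP[].
have [iv|vi] := leqP i (d v); last first.
  apply: le_trans R0; rewrite -[leRHS](pmf_oversize R S vi).
  by apply: card_setId_le => E _ /andP[].
have MH := MD_half; have Mp : 0 < M by rewrite ltr0n M_pos.
have MD : 0 < M - 6 * D%:R ^+ 2 by lra.
have iB : i%:R <= C * g.
  apply: (le_trans iC); have := mulr_ge0 (ltW g0) (ltW C0); lra.
have C1 : 1 <= C by apply: (CX_ge 1).
apply: (le_trans (joint_upper D_pos g_pos g_lt1 M_pos (ltW eps_pos) epsS epsSC
   uS vS uv iu iv C1 iB MD)).
have a8 := CVX_pos 8; have a9 := CVX_pos 9.
(* Both degrees are below C, the denominator is at least M/2 and M >= C^12, so the quotient is at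
   most 8 C^4 / M <= 8 C^-8. *)
have adjF : 4 * C ^+ 2 * ((d u)%:R * (d v)%:R) / (M - 6 * D%:R ^+ 2) <= 8 * C ^- 8.
  rewrite ler_pdivrMr //; apply: (@le_trans _ _ (8 * C ^- 8 * (M / 2))); last first.
    by rewrite ler_wpM2l // mulr_ge0 // ltW.
  have dd : (d u)%:R * (d v)%:R <= C ^+ 2 by rewrite expr2 ler_pM // ltW.
  have c4 : 4 * C ^+ 2 * ((d u)%:R * (d v)%:R) <= 4 * C ^+ 2 * C ^+ 2.
    by rewrite ler_wpM2l // mulr_ge0 // sqr_ge0.
  apply: (le_trans c4).
  have := ler_wpM2l (ltW a8) C12_le_M.
  have -> : C ^- 8 * C ^+ 12 = C ^+ 2 * C ^+ 2 by field; rewrite gt_eqF.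
  by lra.
have F2 : (1 + eps) ^+ (d u + d v) <= 1 + 4 * C ^- 9.
  by apply: pow_eps; rewrite natrD; lra.
have F3 := CVXS 8; have F4 := CVX_le1 8.
have P0 : 0 <= bpmf g (d u) i * bpmf g (d v) i * W.
  by apply: mulr_ge0 => //; apply: mulr_ge0; apply: bpmfd_ge0.
rewrite mulrA -[leRHS]mulrA ler_wpM2r //.
set f := 4 * C ^+ 2 * ((d u)%:R * (d v)%:R) / (M - 6 * D%:R ^+ 2) in adjF *.
have f0 : 0 <= f.
  by rewrite divr_ge0 ?mulr_ge0 ?sqr_ge0 // ltW.
have q0 : 0 <= (1 + eps) ^+ (d u + d v) by rewrite exprn_ge0 // addr_ge0 // ltW // eps_pos.
have f1 : 0 <= 1 + f by lra.
have f2 : 1 + f <= 1 + 8 * C ^- 8 by rewrite lerD2l.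
apply: (@le_trans _ _ ((1 + 8 * C ^- 8) * (1 + 4 * C ^- 9))); first exact: ler_pM.
have : C ^- 8 * C ^- 9 <= C ^- 8 * 1 by rewrite ler_wpM2l ?(ltW a8) // CVX_le1.
by rewrite /kappa; lra.
Qed.

(** Half of gamma C^5 is held back to pay for rounding, for the vertices outside [low], and for
    replacing the mean by n_i(d_H). *)
Definition radius i : R := g * mean i / C ^+ 3 + g * C ^+ 5 / 2.

Definition bad_count i E : bool :=
  radius i < `|\sum_(v in low) (X E v == i)%:R - mean i|.

(** 133 = 1 + 132, one part for each term of the variance. The diagonal term is handled by 4xy <= (x
    + y)^2 with x, y the summands of [radius]; the dependence term, with 132 = 3 * 44, by x^2
    alone. *)
Lemma bad_count_bound i : i%:R <= 2^-1 * g * C ->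
  ngraphs (bad_count i) <= 133 / (g * C) ^+ 2 * W.
Proof.
move=> iC; have C0 := C_pos; have g0 := g_pos; have mu0 := mean_ge0 i.
have x0 : 0 <= g * mean i / C ^+ 3.
  by rewrite divr_ge0 ?exprn_ge0 // ?(ltW C0) // mulr_ge0 // ltW.
have y0 : 0 < g * C ^+ 5 / 2 by rewrite divr_gt0 // mulr_gt0 // exprn_gt0.
have b0 : 0 < radius i by rewrite /radius ltr_wpDl.
have Q0 : 0 < (g * C) ^+ 2 by rewrite exprn_gt0 // mulr_gt0.
have H := chebyshev_count (Om := Om) (T := low) (A := fun v E => X E v == i)
  (p := fun v => bpmf g (d v) i) kappa_ge0 b0 (fun v _ => bpmfd_ge0 v i)
  (fun v vl => low_lower i vl) (fun v vl => low_upper i vl)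
  (fun u v ul vl uv => low_joint ul vl uv iC).
have b2 : 0 < radius i ^+ 2 by rewrite exprn_gt0.
rewrite -(ler_pM2r b2); apply: (le_trans H); rewrite -/(mean i).
rewrite [leRHS]mulrAC ler_wpM2r //.
rewrite [leRHS]mulrAC ler_pdivlMr //.
have k1 := kappa_le1.
have E1 : (1 + kappa) * mean i * (g * C) ^+ 2 <= radius i ^+ 2.
  apply: (@le_trans _ _ (2 * mean i * (g * C) ^+ 2)).
    by rewrite ler_wpM2r ?(ltW Q0) // ler_wpM2r //; lra.
  have -> : 2 * mean i * (g * C) ^+ 2 = 4 * ((g * mean i / C ^+ 3) * (g * C ^+ 5 / 2)).
    by field; rewrite gt_eqF.
  rewrite /radius; set x := g * mean i / _; set y := _ / 2.
  have := sqr_ge0 (x - y); rewrite !expr2; lra.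
have E2 : 3 * kappa * mean i ^+ 2 * (g * C) ^+ 2 <= 132 * radius i ^+ 2.
  have -> : 3 * kappa * mean i ^+ 2 * (g * C) ^+ 2 = 132 * (g * mean i / C ^+ 3) ^+ 2.
    by rewrite /kappa; field; rewrite gt_eqF.
  rewrite ler_wpM2l // lerXn2r ?nnegrE ?(ltW b0) // /radius lerDl ltW //.
by rewrite mulrDl; lra.
Qed.

Lemma nk_dSseq E i : E \in Om ->
  (nk (dSseq E S) i)%:R = \sum_(v in S) (X E v == i)%:R :> R.
Proof.
move=> GE; have sE := graphs_simple GE.
rewrite /nk /dSseq count_map -sum1_count natr_sum big_mkcond /= big_enum /=.
apply: eq_bigr => v vS; rewrite /= gdeg_inE //.
by case: eqP.
Qed.

Lemma m_ge0 : 0 <= m.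
Proof. by rewrite /m !mulr_ge0 ?exprn_ge0 // ?(ltW g_pos) ?(ltW C_pos) ?(ltW e0). Qed.

Lemma not_low v : v \in S -> v \notin low -> m <= g * (d v)%:R /\ g * C <= g * (d v)%:R.
Proof.
move=> vS; rewrite inE vS /= -leNgt => Cd.
have h : g * C <= g * (d v)%:R by rewrite ler_pM2l ?g_pos.
split=> //; apply: le_trans h; rewrite /m ler_piMr ?eX_le1 //.
by rewrite mulr_ge0 ?(ltW g_pos) ?(ltW C_pos).
Qed.

Lemma low_range_lt x y : g * C <= y -> x <= 2^-1 * g * C -> x < (1 - 2 * eta) * y.
Proof.
move=> Cy xC; have e0' := e0; have es := e_small.
have gC0 : 0 < g * C by rewrite mulr_gt0 ?g_pos ?C_pos.
apply: (@lt_le_trans _ _ ((1 - 2 * eta) * (g * C))); last first.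
  by rewrite ler_wpM2l // /eta; lra.
have : 2 * eta * (g * C) <= 4^-1 * (g * C) by rewrite ler_wpM2r ?(ltW gC0) // /eta; lra.
by lra.
Qed.

Lemma nk_dSseq_low E i : E \in Om -> (forall v, v \in S -> ~~ bad_vertex v E) ->
  i%:R <= 2^-1 * g * C ->
  (nk (dSseq E S) i)%:R = \sum_(v in low) (X E v == i)%:R :> R.
Proof.
move=> GE ok iC; rewrite nk_dSseq // (bigID (mem low)) /=.
rewrite [Y in _ + Y]big1 ?addr0; last first.
  move=> v /andP[vS vl]; have [mv gv] := not_low vS vl.
  have := ok v vS; rewrite /bad_vertex mv negb_or => /andP[_]; rewrite -leNgt => H.
  case: eqP => // Xi; have := low_range_lt gv iC.
  by rewrite -Xi ltNge H.
by apply: eq_bigl => v; rewrite !inE andbA andbb.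
Qed.

(** Each vertex of [S] outside [low] puts binomial mass at most [theta] on i, and |S| theta <
    1/2. *)
Lemma mean_low i : i%:R <= 2^-1 * g * C ->
  mean i <= \sum_(v in S) bpmf g (d v) i <= mean i + 2^-1.
Proof.
move=> iC; rewrite [Y in _ <= Y <= _](bigID (mem low)) /=.
have -> : \sum_(v in S | v \in low) bpmf g (d v) i = mean i.
  by apply: eq_bigl => v; rewrite !inE andbA andbb.
rewrite lerDl sumr_ge0 /=; last by move=> v _; apply: bpmfd_ge0.
rewrite lerD2l; apply: le_trans (ltW card_theta_half).
apply: (@le_trans _ _ (\sum_(v in S | v \notin low) theta)).
  apply: ler_sum => v /andP[vS vl]; have [mv gv] := not_low vS vl.
  apply: le_trans (_ : _ <= binom_cdf g (d v) i) _.
    rewrite binom_cdfE big_nat_recr //= lerDr sumr_ge0 // => j _.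
    exact: bpmfd_ge0.
  by apply: (lower_binom (tail_ok_eta mv) (lexx _)); apply/ltW/low_range_lt.
apply: (@le_trans _ _ (\sum_(v in S) theta)).
  rewrite [leRHS](bigID (mem low)) /= lerDr sumr_ge0 // => v _; exact: theta_ge0.
by rewrite sumr_const -[leLHS]mulr_natl.
Qed.

Lemma good_degree E (k : 'I_#|S|) : E \in Om -> ~~ bad_vertex (iS k) E ->
  e ^+ 2 * C <= (d (iS k))%:R ->
  Defs.approx (gdeg_in E S (iS k))%:R (g * (d (iS k))%:R) (8 * e) /\
  Defs.approx (gdeg_in E S (iS k))%:R (nth 0%N dH k)%:R (12 * e).
Proof.
move=> GE ok dk; have sE := graphs_simple GE.
have kS : iS k \in S by apply: enum_valP.
have mk : m <= g * (d (iS k))%:R.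
  by rewrite /m -mulrA [C * _]mulrC ler_pM2l ?g_pos.
move: ok; rewrite /bad_vertex mk negb_or -!leNgt => /andP[Xu Xl].
have ok := tail_ok_eta mk.
have Hu := dH_upper ok (lexx _); have Hl := dH_lower ok (lexx _).
rewrite /Defs.approx gdeg_inE //.
move: Xu Xl Hu Hl; set x : R := (X E _)%:R; set y : R := g * _; set z : R := (nth _ _ _)%:R.
have y0 : 0 <= y by apply: le_trans mk; apply: m_ge0.
have e0' := e0; have es := e_small.
have ey : 0 <= e * y by rewrite mulr_ge0 // ltW.
have E1 : eta * y = 11 / 4 * (e * y) by rewrite [RHS]mulrA.
move=> Xu Xl Hu Hl; split; rewrite ler_norml.
  by apply/andP; split; lra.
have h1 : 100 * (e * y) <= y by rewrite mulrA ler_piMl.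
(* [x] and [z] both lie within 5.5 e y of [y], so they differ by at most 11 e y; z >= (1 - 5.5 e) y
   >= (17/18) y turns this into at most 12 e z. *)
have h2 : e * (17 / 18 * y) <= e * z by rewrite ler_pM2l //; lra.
by apply/andP; split; lra.
Qed.

Lemma good_small_degree E (k : 'I_#|S|) : E \in Om -> ~~ bad_vertex (iS k) E ->
  (d (iS k))%:R < e ^+ 2 * C ->
  (maxn (gdeg_in E S (iS k)) (nth 0%N dH k))%:R <= 2 * g * e ^+ 2 * C.
Proof.
move=> GE ok dk; have sE := graphs_simple GE.
have kS : iS k \in S by apply: enum_valP.
have mk : g * (d (iS k))%:R < m.
  by rewrite /m -mulrA [C * _]mulrC ltr_pM2l ?g_pos.
move: ok; rewrite /bad_vertex leNgt mk /= -leNgt => Xu.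
have Hu := dH_upper tail_ok_half (ltW mk).
have -> : 2 * g * e ^+ 2 * C = (1 + 2 * 2^-1) * m by rewrite /m; field.
by rewrite gdeg_inE // natr_max ge_max Xu Hu.
Qed.

Lemma good_counts E i : E \in Om -> (forall v, v \in S -> ~~ bad_vertex v E) ->
  i%:R <= 2^-1 * g * C -> ~~ bad_count i E ->
  `|(nk (dSseq E S) i)%:R - (nk dH i)%:R| <= g * (nk dH i)%:R / C ^+ 3 + g * C ^+ 5.
Proof.
move=> GE ok iC; rewrite /bad_count -leNgt nk_dSseq_low // /radius.
have C0 := C_pos; have g0 := g_pos; have g1 := g_lt1.
have /andP[] := mean_low iC; have := nk_dHseq g0 g1 i.
set s := \sum_(v in S) _; set y := \sum_(v in low) _; set N := (nk dH i)%:R.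
set mu := mean i; move=> H1 H2 H3 H4.
have p0 : 0 < g / C ^+ 3 by rewrite divr_gt0 // exprn_gt0.
have p1 : g / C ^+ 3 <= 1.
  by rewrite ler_pdivrMr ?exprn_gt0 // mul1r; apply: le_trans (CX_ge 3); apply: ltW.
(* The reserved gamma C^5 / 2 is thus at least 10, against a total loss of 1 + 1/2 + 1. *)
have big : 20 <= g * C ^+ 5.
  rewrite exprS mulrA; apply: (le_trans L_big); apply: (le_trans L_le_gC).
  by rewrite ler_peMr ?CX_ge // mulr_ge0 // ltW.
have HH : g * mu / C ^+ 3 <= g * N / C ^+ 3 + 1.
  rewrite mulrAC [g * N / _]mulrAC.
  apply: (@le_trans _ _ (g / C ^+ 3 * (N + 1))).
    by rewrite ler_pM2l //; move: H1; rewrite ler_norml => /andP[]; lra.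
  by rewrite mulrDr mulr1 lerD2l.
move: H1 H4; rewrite !ler_norml => /andP[? ?] /andP[? ?].
by apply/andP; split; lra.
Qed.

Lemma good_event_of (delta : R) E : 0 < delta -> e = delta `^ 64^-1 ->
  E \in Om -> (forall v, v \in S -> ~~ bad_vertex v E) ->
  (forall i, i%:R <= 2^-1 * g * C -> ~~ bad_count i E) ->
  good_event d S delta E.
Proof.
move=> del0 eE GE okv okc.
have powe k : delta `^ (k%:R / 64) = e ^+ k.
  by rewrite eE -powR_mulrn ?powR_ge0 // -powRrM mulrC.
have E32 : delta `^ 32^-1 = e ^+ 2.
  by rewrite -powe; congr (_ `^ _); field.
have E16 : delta `^ (- 16^-1) = e ^- 4.
  by rewrite powRN -powe; congr (_ `^ _)^-1; field.
have CE' : delta `^ (- 16^-1) * g^-1 * ln M = C.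
  rewrite E16 -LE -CE; field.
  by rewrite !gt_eqF // ?g_pos ?exprn_gt0.
rewrite /good_event CE' E32 -eE; split; [|split].
- by move=> k; apply: good_degree => //; apply: okv; apply: enum_valP.
- by move=> k; apply: good_small_degree => //; apply: okv; apply: enum_valP.
- by move=> i iC; apply: good_counts => //; apply: okc.
Qed.

Lemma finite_bound (delta : R) : 0 < delta -> e = delta `^ 64^-1 ->
  #|[set E in Om | ~~ `[< good_event d S delta E >]]|%:R <= 134 / L * W.
Proof.
move=> del0 eE; have L0 := L_pos; have g0 := g_pos; have C0 := C_pos.
have gC0 : 0 < g * C by rewrite mulr_gt0.
have x0 : 0 <= 2^-1 * g * C by rewrite -mulrA mulr_ge0 // ltW.
set K := (Num.trunc (2^-1 * g * C)).+1.
have /andP[Kl Ku] := Num.Theory.truncn_itv x0.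
pose P1 E := [exists v in S, bad_vertex v E].
pose P2 E := [exists i in [set: 'I_K], bad_count i E].
apply: (@le_trans _ _ (ngraphs (fun E => P1 E || P2 E))).
  apply: card_setId_le => E GE; apply: contraR; rewrite negb_or => /andP[n1 n2].
  apply/asboolP; apply: good_event_of => // [v vS|i iC].
    by apply: contra n1 => bv; apply/existsP; exists v; rewrite vS.
  have iK : (i < K)%N by rewrite -(ltr_nat R); apply: le_lt_trans Ku.
  by apply: contra n2 => bi; apply/existsP; exists (Ordinal iK); rewrite inE.
apply: (le_trans (card_setIdU_le _ _ _ _)).
(* The first share pays for vertices, 2 |S| theta <= 1/L; the second for counts, at most gamma C
   values of i at 133/(gamma C)^2 each, with gamma C >= L. *)
have -> : 134 / L * W = 1 / L * W + 133 / L * W by ring.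
apply: lerD.
  apply: (le_trans (card_setId_exists_le _ _ _ _)).
  apply: (@le_trans _ _ (\sum_(v in S) 2 * theta * W)).
    by apply: ler_sum => v _; apply: bad_vertex_count.
  rewrite sumr_const -[leLHS]mulr_natl mulrA ler_wpM2r //.
  have := card_theta; rewrite invfM.
  rewrite [#|S|%:R * (2 * theta)]mulrCA; lra.
apply: (le_trans (card_setId_exists_le _ _ _ _)).
apply: (@le_trans _ _ (\sum_(i in [set: 'I_K]) 133 / (g * C) ^+ 2 * W)).
  apply: ler_sum => i _; apply: bad_count_bound; apply: le_trans Kl.
  by rewrite ler_nat -ltnS.
rewrite sumr_const cardsT card_ord -[leLHS]mulr_natl mulrA ler_wpM2r //.
have LgC := L_le_gC; have LL := L_big.
have KgC : K%:R <= g * C.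
  by rewrite /K -natr1; lra.
apply: (@le_trans _ _ (g * C * (133 / (g * C) ^+ 2))).
  by rewrite ler_wpM2r // divr_ge0 // ltW // exprn_gt0.
have -> : g * C * (133 / (g * C) ^+ 2) = 133 / (g * C) by field; rewrite !gt_eqF.
by rewrite ler_pM2l // lef_pV2 ?posrE.
Qed.

End Finite.

Unset Implicit Arguments. Set Strict Implicit. Set Printing Implicit Defensive.

(* Asymptotic setting: for each n a degree sequence d n on 'I_n, a set S n,
   and delta n.  "with probability 1 - O(1/sqrt(log M))" is rendered as:
   the number of graphs with degree sequence d outside the event is at most
   K / sqrt(ln M) times the number of all graphs with degree sequence d,
   for all sufficiently large n. *)
Theorem theorem2p3 (R : realType)
    (d : forall n : nat, 'I_n -> nat) (S : forall n : nat, {set 'I_n})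
    (delta : nat -> R) (c : R) :
  (* degree sequences: 1 <= d(1) <= ... <= d(n), even sum *)
  (forall n (i j : 'I_n), (i <= j)%N -> (d n i <= d n j)%N) ->
  (forall n (i : 'I_n), (1 <= d n i)%N) ->
  (forall n, ~~ odd (Msum (d n))) ->
  (* M -> infinity *)
  (forall B : nat, exists N, forall n, (N <= n)%N -> (B <= Msum (d n))%N) ->
  (* delta -> 0 *)
  (forall eps : R, 0 < eps -> exists N, forall n, (N <= n)%N -> `|delta n| < eps) ->
  (* delta^{-1} = O(log log M) *)
  (exists K : R, exists N, forall n, (N <= n)%N ->
      0 < delta n /\ (delta n)^-1 <= K * ln (ln ((Msum (d n))%:R))) ->
  (* Delta^2 (gamma^{-1} log M)^12 <= delta d(S); gamma < 1 - c, c > 0 constant *)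
  0 < c ->
  (exists N, forall n, (N <= n)%N ->
      (0 < #|S n|)%N /\
      ((maxdeg (d n))%:R ^+ 2 * ((gam (d n) (S n) : R)^-1 * ln ((Msum (d n))%:R)) ^+ 12
         <= delta n * (dset (d n) (S n))%:R) /\
      (gam (d n) (S n) : R) < 1 - c) ->
  exists K : R, exists N, forall n, (N <= n)%N ->
    (#|[set E in graphs_deg (d n) | ~~ `[< good_event (d n) (S n) (delta n) E >]]|)%:R
      <= K / Num.sqrt (ln ((Msum (d n))%:R)) * (#|graphs_deg (d n)|)%:R.
Proof.
move=> d_mono d_pos _ Minf del0 [K1 [N1 H1]] c0 [N2 H2].
(* Large enough to force log M >= 20 + 12/c, which covers both numerical demands on L. *)
have [N3 H3] := Minf (Num.trunc (expR (20 + 12 / c : R))).+1.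
(* The 64th power of the bound wanted for e = delta^(1/64). *)
have p100 : 0 < (100^-1 : R) ^+ 64 by rewrite exprn_gt0.
have [N4 H4] := del0 _ p100.
exists 134, (N1 + N2 + N3 + N4)%N => n nN.
have [dp _] := H1 n ltac:(lia).
have [Sp [Hkey gc]] := H2 n ltac:(lia).
have /= HM := H3 n ltac:(lia).
have Hd := H4 n ltac:(lia).
set L : R := ln (Msum (d n))%:R.
have LB : 20 + 12 / c <= L.
  have e0 : 0 <= expR (20 + 12 / c : R) by apply: expR_ge0.
  have eM : expR (20 + 12 / c : R) <= (Msum (d n))%:R.
    have /andP[_ /ltW h] := Num.Theory.truncn_itv e0.
    by apply: (le_trans h); rewrite ler_nat.
  rewrite -[leLHS]expRK /L ler_ln ?posrE ?expR_gt0 //.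
  by apply: lt_le_trans eM; apply: expR_gt0.
have c12 : 0 < 12 / c by rewrite divr_gt0.
have L20 : 20 <= L by lra.
have L0 : 0 < L by lra.
have Lc : 12 <= c * L.
  have := ler_wpM2l (ltW c0) LB; have -> : c * (20 + 12 / c) = 20 * c + 12.
    by field; rewrite gt_eqF.
  lra.
set e : R := delta n `^ 64^-1.
have e0 : 0 < e by rewrite powR_gt0.
have e64 : e ^+ 64 = delta n.
  by rewrite /e -powR_mulrn ?powR_ge0 // -powRrM mulVf ?pnatr_eq0 // powRr1 // ltW.
have es : 100 * e <= 1.
  rewrite mulrC -ler_pdivlMr // div1r leNgt; apply/negP => el.
  move: Hd; rewrite gtr0_norm // -e64 ltNge => /negP; apply.
  by rewrite lerXn2r ?nnegrE // ?ltW.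
have g0 : 0 < (gam (d n) (S n) : R) by apply: g_pos.
have eg0 : 0 < e ^+ 4 * gam (d n) (S n) by rewrite mulr_gt0 // exprn_gt0.
set C : R := L / (e ^+ 4 * gam (d n) (S n)).
have CE : C * (e ^+ 4 * gam (d n) (S n)) = L by rewrite /C mulfVK // gt_eqF.
have key : (maxdeg (d n))%:R ^+ 2 * C ^+ 12
    <= e ^+ 16 * (gam (d n) (S n) * (Msum (d n))%:R).
  rewrite gamM; last exact: (M_pos (d_pos n) Sp).
  (* C^12 carries e^-48; multiplying by e^48 clears it and completes e^16 to e^64 = delta. *)
  rewrite -(ler_pM2l (exprn_gt0 48 e0)) [leRHS]mulrA -exprD e64.
  apply: le_trans Hkey; rewrite -/L /C le_eqVlt; apply/orP; left; apply/eqP.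
  by field; rewrite !gt_eqF.
apply: (le_trans (finite_bound (d_mono n) (d_pos n) Sp e0 es erefl L20 c0 Lc gc
  CE key dp erefl)).
rewrite ler_wpM2r // ler_pM2l // lef_pV2 ?posrE ?sqrtr_gt0 //.
(* The failure bound obtained is 134 / log M, which is at most 134 / sqrt(log M) once log M >= 1. *)
have L1 : 1 <= L by lra.
rewrite -[leRHS](sqr_sqrtr (ltW L0)) expr2 ler_peMl ?sqrtr_ge0 //.
by rewrite -[leLHS]sqrtr1 ler_wsqrtr.
Qed.
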